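(* Let $m\ge1$ and let $E$ be a commutative, additively finite, additive monoid with zero $0$ such that $E\setminus\{0\}$ is a subsemigroup. The algebra $\mathrm{MQSym}^E$ of multi-quasisymmetric functions with exponents in $E$ is a Hopf algebra over $\mathbf k$ with coproduct $\Delta$, counit $\epsilon$ and antipode $S$ the linear maps defined, for $\mathbf w=(w_1,\dots,w_n)\in\mathcal{MC}(E)$, by $$\Delta(M_{\mathbf w})=\sum_{i=0}^nM_{(w_1,\dots,w_i)}\otimes M_{(w_{i+1},\dots,w_n)},\qquad \epsilon(M_{\mathbf w})=\delta_{\mathbf w,\mathbb 1},\qquad S(M_{\mathbf w})=(-1)^{\ell(\mathbf w)}\sum_{L\models\ell(\mathbf w)}M_{L\circ\mathbf w^r},$$ with $S(M_{\mathbb 1})=M_{\mathbb 1}=1_{\mathbf k}$, where $\mathbb 1$ denotes the multi-composition of length $0$.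
   Context: $\mathbf k$ is a commutative unitary ring containing $\mathbb Q$; $[m]=\{1,\dots,m\}$, $\mathbb P=\{1,2,\dots\}$. $E$ additively finite means: for each $a\in E$ there are only finitely many $(a_1,a_2)\in E^2$ with $a_1+a_2=a$. $[m]^E$ denotes the monoid of all maps $[m]\to E$ under pointwise addition. $\mathcal{MC}(E)$ is the set of multi-compositions with exponents in $E$: finite sequences $\mathbf w=(w_1,\dots,w_n)$, $n\ge0$, of elements of $[m]^E$ none of which is the zero map; $\ell(\mathbf w)=n$, and $\mathbb 1$ is the empty sequence. Let $X=\{x_{i,j}\mid i\in[m],j\in\mathbb P\}$. Monomials with exponents in $E$ are finitely supported maps $X\to E$, written $\prod x_{i,j}^{a_{i,j}}$ (with $x^0=1$), multiplied by adding exponents; $\mathbf k[[X]]^E$ is the algebra of possibly infinite $\mathbf k$-linear combinations of such monomials. For $w\in[m]^E$ and $j\in\mathbb P$, $x_j^w:=\prod_{i\in[m]}x_{i,j}^{w(i)}$. For $\mathbf w=(w_1,\dots,w_n)\in\mathcal{MC}(E)$, $M_{\mathbf w}:=\sum_{1\le j_1<\cdots<j_n}x_{j_1}^{w_1}\cdots x_{j_n}^{w_n}\in\mathbf k[[X]]^E$, $M_{\mathbb 1}=1_{\mathbf k}$. $\mathrm{MQSym}^E$ is the $\mathbf k$-span of $\{M_{\mathbf w}\mid\mathbf w\in\mathcal{MC}(E)\}$; it is a subalgebra of $\mathbf k[[X]]^E$ with the $M_{\mathbf w}$ as a basis. $L\models n$ means $L=(\ell_1,\dots,\ell_k)$ is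 a composition of $n$ (positive integers with sum $n$). $\mathbf w^r=(w_n,\dots,w_1)$, and $L\circ(u_1,\dots,u_n)=(u_1+\cdots+u_{\ell_1},\ u_{\ell_1+1}+\cdots+u_{\ell_1+\ell_2},\ \dots,\ u_{\ell_1+\cdots+\ell_{k-1}+1}+\cdots+u_n)$ with sums in $[m]^E$. *)

(* Defs.v *)
From HB Require Import structures.
From mathcomp Require Import all_boot all_order all_algebra.
From mathcomp Require Import generic_quotient ring_quotient.
From mathcomp Require Import finmap.
From mathcomp Require Import mathcomp_extra boolp classical_sets functions.
From mathcomp Require Import cardinality fsbigop.
From mathcomp Require Import monalg.

Set Implicit Arguments.
Unset Strict Implicit.
Unset Printing Implicit Defensive.

Import GRing.Theory.
Local Open Scope classical_set_scope.
Local Open Scope quotient_scope.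
Local Open Scope ring_scope.

Section Span.
Context (k : nzRingType) (V : lmodType k) (S : set V).

Definition kspan : set V :=
  [set x | exists2 s : seq (k * V), {in s, forall p, S p.2} &
                                    x = \sum_(p <- s) p.1 *: p.2].

Definition kspanp : {pred V} := [pred x | `[< kspan x >]].

Lemma kspanpP x : reflect (kspan x) (x \in kspanp).
Proof. exact: asboolP. Qed.

Lemma kspan_gen x : S x -> x \in kspanp.
Proof.
move=> Sx; apply/kspanpP; exists [:: (1, x)]; last by rewrite big_seq1 scale1r.
by move=> p; rewrite mem_seq1 => /eqP ->; exact: Sx.
Qed.

Lemma kspanp_submod : submod_closed kspanp.
Proof.
split; first by apply/kspanpP; exists [::]; rewrite ?big_nil.
move=> a x y /kspanpP[s sS ->] /kspanpP[t tS ->]; apply/kspanpP.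
exists ([seq (a * p.1, p.2) | p <- s] ++ t).
  move=> p; rewrite mem_cat => /orP[/mapP[q qs ->]|]; last exact: tS.
  exact: (sS q qs).
rewrite big_cat big_map scaler_sumr; congr (_ + _).
by apply: eq_bigr => p _; rewrite scalerA.
Qed.

HB.instance Definition _ := GRing.isSubmodClosed.Build k V kspanp kspanp_submod.

Lemma kspan_ind (P : V -> Prop) : P 0 ->
  (forall a x y, S x -> P y -> P (a *: x + y)) -> {in kspanp, forall x, P x}.
Proof.
move=> P0 PD x /kspanpP[s sS ->]; elim: s sS => [|p s IH] sS.
  by rewrite big_nil.
rewrite big_cons; apply: PD; first by apply: sS; rewrite mem_head.
by apply: IH => q qs; apply: sS; rewrite in_cons qs orbT.
Qed.

End Span.

Section Tensor.
Context (k : comNzRingType).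
Implicit Types (M N P : lmodType k).

(* The tensor product over k, as the free module on M * N modulo the submodule
   spanned by the bilinearity relations. *)
Section Def.
Context M N.
Notation free := {malg k[(M * N)%type]}.

Definition tensor_rel : set free :=
  [set r | (exists a x x' y,
              r = << (a *: x + x', y) >> - (a *: << (x, y) >> + << (x', y) >>))
        \/ (exists a x y y',
            r = << (x, a *: y + y') >> - (a *: << (x, y) >> + << (x, y') >>))].

Definition tensor := Quotient.quot (kspanp tensor_rel).
HB.instance Definition _ := GRing.Zmodule.on tensor.

Definition tpi (z : free) : tensor := \pi_tensor z.
Definition tens (x : M) (y : N) : tensor := tpi << (x, y) >>.
Definition tscale (a : k) (t : tensor) : tensor := tpi (a *: repr t).

Lemma tpiK t : tpi (repr t) = t. Proof. exact: reprK. Qed.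
Lemma tpi_eq z z' : z - z' \in kspanp tensor_rel -> tpi z = tpi z'.
Proof. by rewrite Quotient.idealrBE => /eqP. Qed.
Lemma tpi_repr z : repr (tpi z) - z \in kspanp tensor_rel.
Proof. by rewrite Quotient.idealrBE; apply/eqP; exact: reprK. Qed.
Lemma tpiD : {morph tpi : x y / x + y}. Proof. exact: raddfD. Qed.
Lemma tpi0 : tpi 0 = 0. Proof. exact: raddf0. Qed.

Lemma tscale_pi a z : tscale a (tpi z) = tpi (a *: z).
Proof. by apply: tpi_eq; rewrite -scalerBr rpredZ // tpi_repr. Qed.

Lemma tscaleA a b t : tscale a (tscale b t) = tscale (a * b) t.
Proof. by rewrite -[t]tpiK !tscale_pi scalerA. Qed.
Lemma tscale1 : left_id 1 tscale.
Proof. by move=> t; rewrite -[t]tpiK tscale_pi scale1r. Qed.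
Lemma tscaleDr : right_distributive tscale +%R.
Proof.
by move=> a t u; rewrite -[t]tpiK -[u]tpiK -tpiD !tscale_pi -tpiD scalerDr.
Qed.
Lemma tscaleDl t : {morph tscale^~ t : a b / a + b}.
Proof. by move=> a b; rewrite -[t]tpiK !tscale_pi -tpiD scalerDl. Qed.

HB.instance Definition _ := GRing.Zmodule_isLmodule.Build k tensor
  tscaleA tscale1 tscaleDr tscaleDl.

Lemma tpiZ a z : tpi (a *: z) = a *: tpi z.
Proof. by rewrite -tscale_pi. Qed.

End Def.

Definition bilin M N P (f : M -> N -> P) :=
  (forall x, linear (f x)) /\ (forall y, linear (f^~ y)).

Lemma tens_bilin M N : bilin (@tens M N).
Proof.
split=> [x a y y'|y a x x']; rewrite /tens -tpiZ -tpiD; apply: tpi_eq;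
  apply: kspan_gen.
- by right; exists a, x, y, y'.
- by left; exists a, x, x', y.
Qed.

(* The linear map induced by f; only meaningful when f is bilinear. *)
Definition tlift M N P (f : M -> N -> P) (t : tensor M N) : P :=
  \sum_(p <- msupp (repr t)) (repr t)@_p *: f p.1 p.2.

Section Lift.
Context M N P (f : M -> N -> P).
Notation free := {malg k[(M * N)%type]}.

Let fext (z : free) : P := \sum_(p <- msupp z) z@_p *: f p.1 p.2.

Let fextE (d : {fset (M * N)%type}) (z : free) :
  (msupp z `<=` d)%fset -> fext z = \sum_(p <- d) z@_p *: f p.1 p.2.
Proof.
move=> sd; rewrite /fext (big_fset_incl _ sd) // => p _ /mcoeff_outdom ->.
by rewrite scale0r.
Qed.

Let fext_lin : linear fext.
Proof.
move=> a z z'.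
pose d := (msupp (a *: z + z') `|` (msupp z `|` msupp z'))%fset.
have s0 : (msupp (a *: z + z') `<=` d)%fset by rewrite /d; apply: fsubsetUl.
have s1 : (msupp z `<=` d)%fset by rewrite /d fsubsetU // fsubsetUl orbT.
have s2 : (msupp z' `<=` d)%fset by rewrite /d fsubsetU // fsubsetUr orbT.
rewrite (fextE s0) (fextE s1) (fextE s2) scaler_sumr -big_split.
by apply: eq_bigr => p _ /=; rewrite mcoeffD mcoeffZ scalerDl scalerA.
Qed.

HB.instance Definition _ := GRing.isLinear.Build k free P _ fext fext_lin.

Let fextU p : fext << p >> = f p.1 p.2.
Proof. by rewrite /fext msuppU oner_eq0 big_seq_fset1 mcoeffUU scale1r. Qed.

Hypothesis fB : bilin f.

Let fext0 z : z \in kspanp (@tensor_rel M N) -> fext z = 0.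
Proof.
move: z; apply: kspan_ind => [|a z z' + IH]; first exact: linear0.
rewrite linearP /= IH addr0.
by case=> [[b [x [x' [y ->]]]]|[b [x [y [y' ->]]]]];
  rewrite linearB linearP /= !fextU (fB.1, fB.2) subrr scaler0.
Qed.

Lemma tlift_pi z : tlift f (tpi z) = fext z.
Proof.
rewrite -[tlift _ _]/(fext _); apply/eqP; rewrite -subr_eq0 -linearB /=.
by rewrite fext0 ?tpi_repr.
Qed.

Lemma tlift_lin : linear (tlift f).
Proof.
by move=> a t u; rewrite -[t]tpiK -[u]tpiK -tpiZ -tpiD !tlift_pi linearP.
Qed.

Lemma tliftE x y : tlift f (tens x y) = f x y.
Proof. by rewrite tlift_pi fextU. Qed.

End Lift.

Lemma tensor_ind M N (Q : tensor M N -> Prop) : Q 0 ->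
  (forall a x y t, Q t -> Q (a *: tens x y + t)) -> forall t, Q t.
Proof.
move=> Q0 QD t; rewrite -[t]tpiK [repr t]monalgE.
elim: (msupp _ : seq _) => [|p s IH]; first by rewrite big_nil tpi0.
rewrite big_cons tpiD; set c := _@_p.
have -> : << c *g p >> = c *: << p >> :> {malg k[(M * N)%type]}.
  apply/malgP => q; rewrite mcoeffZ !mcoeffU.
  by case: eqP; rewrite ?mulr1 ?mulr0.
by rewrite tpiZ; case: p => x y in c *; exact: QD.
Qed.

End Tensor.

Section TensorTheory.
Context (k : comNzRingType).
Implicit Types (M N P : lmodType k).

Lemma tensor_eq M N P (f g : tensor M N -> P) : linear f -> linear g ->
  (forall x y, f (tens x y) = g (tens x y)) -> f =1 g.
Proof.
move=> fl gl fg.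
have lin0 (h : tensor M N -> P) : linear h -> h 0 = 0.
  by move=> /(_ (-1) 0 0); rewrite scaler0 addr0 scaleN1r addNr.
apply: tensor_ind => [|a x y t IH]; first by rewrite !lin0.
by rewrite fl gl fg IH.
Qed.

Lemma eq_tlift M N P (f g : M -> N -> P) t :
  (forall x y, f x y = g x y) -> tlift f t = tlift g t.
Proof. by move=> fg; apply: eq_bigr => p _; rewrite fg. Qed.

Lemma tlift_linf M N P a (f g : M -> N -> P) t :
  tlift (fun x y => a *: f x y + g x y) t = a *: tlift f t + tlift g t.
Proof.
rewrite /tlift scaler_sumr -big_split; apply: eq_bigr => p _ /=.
by rewrite scalerDr !scalerA mulrC.
Qed.

Lemma bilin_tlift M N M' N' P (f : M -> N -> M' -> N' -> P) t :
  (forall x' y', bilin (fun x y => f x y x' y')) ->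
  bilin (fun x y => tlift (f x y) t).
Proof.
move=> fB; split=> [x|y] a u v; rewrite -tlift_linf; apply: eq_tlift => x' y'.
- exact: (fB x' y').1.
- exact: (fB x' y').2.
Qed.

End TensorTheory.

Section TensorAlgebra.
Context (k : comNzRingType) (A B : algType k).
Local Notation T := (tensor A B).

Definition tone : T := tens 1 1.
Definition tmul (t u : T) : T :=
  tlift (fun a b => tlift (fun c d => tens (a * c) (b * d)) u) t.

Let in_bilin (a : A) (b : B) :
  bilin (fun (c : A) (d : B) => tens (a * c) (b * d)).
Proof.
have [tr tl] := tens_bilin A B.
by split=> [c|d] s x y; rewrite mulrDr -scalerAr ?tr //; exact: (tl _ s).
Qed.

Let out_bilin (u : T) :
  bilin (fun (a : A) (b : B) => tlift (fun c d => tens (a * c) (b * d)) u).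
Proof.
have [tr tl] := tens_bilin A B; apply: bilin_tlift => c d.
by split=> [a|b] s x y; rewrite mulrDl -scalerAl ?tr //; exact: (tl _ s).
Qed.

Lemma tmul_tens a b c d : tmul (tens a b) (tens c d) = tens (a * c) (b * d).
Proof. by rewrite /tmul (tliftE (out_bilin _)) (tliftE (in_bilin _ _)). Qed.

Lemma tmul_linl u : linear (tmul^~ u).
Proof. exact: tlift_lin (out_bilin u). Qed.

Lemma tmul_linr t : linear (tmul t).
Proof.
move=> s u v; rewrite /tmul -tlift_linf; apply: eq_tlift => a b.
exact: tlift_lin (in_bilin a b) s u v.
Qed.

Lemma tmulA : associative tmul.
Proof.
move=> t u v; move: t; apply: tensor_eq => [a t t'|a t t'|a b].
- by rewrite tmul_linl.
- by rewrite !tmul_linl.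
move: u; apply: tensor_eq => [s u u'|s u u'|c d].
- by rewrite tmul_linl tmul_linr.
- by rewrite tmul_linr tmul_linl.
move: v; apply: tensor_eq => [s v v'|s v v'|e f].
- by rewrite !tmul_linr.
- by rewrite tmul_linr.
by rewrite !tmul_tens !mulrA.
Qed.

Lemma tmul1t : left_id tone tmul.
Proof.
apply: tensor_eq => [s u u'|//|a b]; first by rewrite tmul_linr.
by rewrite tmul_tens !mul1r.
Qed.

Lemma tmult1 : right_id tone tmul.
Proof.
apply: tensor_eq => [s u u'|//|a b]; first by rewrite tmul_linl.
by rewrite tmul_tens !mulr1.
Qed.

Lemma tmulDl : left_distributive tmul +%R.
Proof. by move=> t u v; have := tmul_linl v 1 t u; rewrite !scale1r. Qed.

Lemma tmulDr : right_distributive tmul +%R.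
Proof. by move=> t u v; have := tmul_linr t 1 u v; rewrite !scale1r. Qed.

(* Only a possibly zero ring: the tensor product of nonzero algebras can be
   zero. *)
HB.instance Definition _ := GRing.Zmodule_isPzRing.Build (tensor A B)
  tmulA tmul1t tmult1 tmulDl tmulDr.

End TensorAlgebra.

Section HopfDef.
Context (k : comNzRingType).

Definition tmap (M N M' N' : lmodType k) (f : M -> M') (g : N -> N') :
  tensor M N -> tensor M' N' := tlift (fun x y => tens (f x) (g y)).

Definition tassoc (M N P : lmodType k) :
  tensor (tensor M N) P -> tensor M (tensor N P) :=
  tlift (fun t z => tlift (fun x y => tens x (tens y z)) t).

(* All maps passed to tlift below are bilinear when Delta, eps and S are
   linear, so these are the maps induced on the tensor product. *)
Record is_coalgebra (C : lmodType k) (Delta : {linear C -> tensor C C})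
    (eps : {scalar C}) : Prop := {
  coalg_assoc : forall x, tassoc (tmap Delta id (Delta x)) =
                          tmap id Delta (Delta x);
  coalg_unitl : forall x, tlift (fun y z => eps y *: z) (Delta x) = x;
  coalg_unitr : forall x, tlift (fun y z => eps z *: y) (Delta x) = x
}.

Record is_bialgebra (A : algType k) (Delta : {linear A -> tensor A A})
    (eps : {scalar A}) : Prop := {
  bialg_coalg : is_coalgebra Delta eps;
  bialg_comul : monoid_morphism Delta;
  bialg_counit : monoid_morphism eps
}.

Record is_hopf_algebra (A : algType k) (Delta : {linear A -> tensor A A})
    (eps : {scalar A}) (S : {linear A -> A}) : Prop := {
  hopf_bialg : is_bialgebra Delta eps;
  hopf_antipodel : forall x, tlift (fun y z => S y * z) (Delta x) = (eps x)%:A;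
  hopf_antipoder : forall x, tlift (fun y z => y * S z) (Delta x) = (eps x)%:A
}.

End HopfDef.

HB.mixin Record isAddFinite E of GRing.Nmodule E := {
  finite_decomp : forall a : E, finite_set [set p : E * E | p.1 + p.2 = a]
}.
#[short(type="addFiniteType")]
HB.structure Definition AddFinite := {E of GRing.Nmodule E & isAddFinite E}.

(* The field add_neq0 says that the nonzero elements form a subsemigroup. *)
HB.mixin Record AddFinite_isExponent E of AddFinite E := {
  add_neq0 : forall a b : E, a != 0 -> b != 0 -> a + b != 0
}.
#[short(type="exponentType")]
HB.structure Definition Exponent := {E of AddFinite E & AddFinite_isExponent E}.

(* Possibly infinite k-linear combinations of elements of the (additively
   written) monoid G, as coefficient functions. *)
Definition series (k : comNzRingType) (G : addFiniteType) : Type := G -> k.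

Section Series.
Context (k : comNzRingType) (G : addFiniteType).
Local Notation series := (series k G).

HB.instance Definition _ := Choice.copy series (G -> k).

Definition series0 : series := fun=> 0.
Definition series_opp (f : series) : series := fun a => - f a.
Definition series_add (f g : series) : series := fun a => f a + g a.
Definition series_scale (c : k) (f : series) : series := fun a => c * f a.
Definition series1 : series := fun a => (a == 0)%:R.
Definition series_mul (f g : series) : series := fun a =>
  \sum_(p \in [set p : G * G | p.1 + p.2 = a]) f p.1 * g p.2.

Let addA : associative series_add.
Proof. by move=> f g h; apply/funext => a; exact: addrA. Qed.
Let addC : commutative series_add.
Proof. by move=> f g; apply/funext => a; exact: addrC. Qed.
Let add0 : left_id series0 series_add.
Proof. by move=> f; apply/funext => a; exact: add0r. Qed.
Let addN : left_inverse series0 series_opp series_add.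
Proof. by move=> f; apply/funext => a; exact: addNr. Qed.
HB.instance Definition _ := GRing.isZmodule.Build series addA addC add0 addN.

Lemma seriesDE (f g : series) a : (f + g) a = f a + g a. Proof. by []. Qed.
Lemma series0E a : (0 : series) a = 0. Proof. by []. Qed.

Lemma series_sumE I (r : seq I) (P : pred I) (F : I -> series) a :
  (\sum_(i <- r | P i) F i) a = \sum_(i <- r | P i) F i a.
Proof. by elim/big_rec2: _ => // i x y _ <-. Qed.

Definition divisors (a : G) : {fset G} :=
  [fset p.1 | p in fset_set [set p : G * G | (p.1 + p.2)%R = a]]%fset.

Lemma divisorsP a b : reflect (exists c, b + c = a) (b \in divisors a).
Proof.
apply: (iffP idP) => [/imfsetP[[x y]] /=|[c <-]].
  rewrite in_fset_set ?inE /=; last exact: finite_decomp.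
  by move=> <- ->; exists y.
apply/imfsetP; exists (b, c) => //=.
by rewrite in_fset_set ?inE //; exact: finite_decomp.
Qed.

Lemma series_mulE (D : {fset G}) (f g : series) a :
  (forall b c, b + c = a -> b \in D) ->
  series_mul f g a =
  \sum_(b <- D) \sum_(c <- D) (if b + c == a then f b * g c else 0).
Proof.
move=> HD; rewrite /series_mul fsbig_finite; last exact: finite_decomp.
transitivity (\sum_(p <- [seq (b, c) | b <- D, c <- D])
    (if p.1 + p.2 == a then f p.1 * g p.2 else 0)).
  2: by rewrite big_allpairs.
rewrite -big_mkcond -[RHS]big_filter; apply: perm_big; apply: uniq_perm.
- exact: fset_uniq.
- by rewrite filter_uniq // allpairs_uniq // => -[? ?] [? ?].
move=> [b c]; rewrite in_fset_set; last exact: finite_decomp.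
rewrite mem_filter /=; apply/idP/idP; rewrite inE /=; last by case/andP => /eqP.
move=> e; rewrite e eqxx /=; apply/allpairsP; exists (b, c).
by split=> //=; [exact: HD e | apply: (HD c b); rewrite addrC].
Qed.

Lemma series_mulE_div f g a : series_mul f g a =
  \sum_(b <- divisors a) \sum_(c <- divisors a)
     (if b + c == a then f b * g c else 0).
Proof. by apply: series_mulE => b c <-; apply/divisorsP; exists c. Qed.

Let mulC : commutative series_mul.
Proof.
move=> f g; apply/funext => a; rewrite !series_mulE_div exchange_big.
by apply: eq_bigr => b _; apply: eq_bigr => c _; rewrite addrC mulrC.
Qed.

Let mul3E f g h a : series_mul f (series_mul g h) a =
  \sum_(b <- divisors a) \sum_(c <- divisors a) \sum_(d <- divisors a)
    (if b + c + d == a then f b * g c * h d else 0).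
Proof.
set D := divisors a.
have DP b c : b + c = a -> b \in D by move=> bc; apply/divisorsP; exists c.
have DP' b : b \in D -> forall x y, x + y = b -> x \in D.
  move=> /divisorsP[c bc] x y xy; apply/divisorsP; exists (y + c).
  by rewrite addrA xy.
rewrite (series_mulE _ _ DP); apply: eq_bigr => b _.
under eq_big_seq => e eD.
  rewrite (series_mulE _ _ (DP' _ eD)).
  rewrite (_ : (if _ then _ else _) = \sum_(c <- D) \sum_(d <- D)
    (if (c + d == e) && (b + e == a) then f b * g c * h d else 0)); last first.
    case: ifP => _; last first.
      by rewrite big1 // => c _; rewrite big1 // => d _; rewrite andbF.
    rewrite mulr_sumr; apply: eq_bigr => c _; rewrite mulr_sumr.
    by apply: eq_bigr => d _; rewrite andbT; case: ifP; rewrite ?mulr0 ?mulrA.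
  over.
rewrite exchange_big; apply: eq_bigr => c _; rewrite exchange_big.
apply: eq_bigr => d _; case: ifP => [e|ne].
  have cdD : c + d \in D.
    by apply: (DP _ b); rewrite addrC addrA; exact/eqP.
  rewrite (big_fsetD1 _ cdD) /= eqxx addrA e /= big1_fset ?addr0 // => x.
  by rewrite !inE eq_sym => /andP[/negPf-> _].
rewrite big1 // => x _; case: ifP => // /andP[/eqP <- ].
by rewrite addrA ne.
Qed.

Let mulA : associative series_mul.
Proof.
move=> f g h; rewrite (mulC (series_mul f g)); apply/funext => a.
rewrite !mul3E [RHS]exchange_big; apply: eq_bigr => b _.
rewrite [RHS]exchange_big; apply: eq_bigr => c _; apply: eq_bigr => d _.
by rewrite -[d + b + c]addrA (addrC d) -[h d * _ * _]mulrA (mulrC (h d)).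
Qed.

Let mul1 : left_id series1 series_mul.
Proof.
move=> f; apply/funext => a; rewrite series_mulE_div.
have D0 : 0 \in divisors a by apply/divisorsP; exists a; rewrite add0r.
have Da : a \in divisors a by apply/divisorsP; exists 0; rewrite addr0.
rewrite (big_fsetD1 _ D0) /= (big_fsetD1 _ Da) /= /series1 add0r !eqxx mul1r.
rewrite !big1_fset ?addr0 // => b; rewrite !inE => /andP[/negPf b0 _].
  by move=> _; rewrite big1 // => c _; rewrite b0 mul0r if_same.
by rewrite add0r b0.
Qed.

Let mulDl : left_distributive series_mul series_add.
Proof.
move=> f g h; apply/funext => a.
rewrite /series_add !series_mulE_div -big_split.
apply: eq_bigr => b _; rewrite -big_split; apply: eq_bigr => c _ /=.
by case: ifP => _; rewrite ?addr0 ?mulrDl.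
Qed.

Let one_neq0 : series1 != 0.
Proof.
apply/eqP => /(congr1 (fun f : series => f 0)).
by rewrite /series1 eqxx; apply/eqP; exact: oner_neq0.
Qed.

HB.instance Definition _ := GRing.Zmodule_isComNzRing.Build series
  mulA mulC mul1 mulDl one_neq0.

Let scaleA c d f : series_scale c (series_scale d f) = series_scale (c * d) f.
Proof. by apply/funext => a; exact: mulrA. Qed.
Let scale1 : left_id 1 series_scale.
Proof. by move=> f; apply/funext => a; exact: mul1r. Qed.
Let scaleDr : right_distributive series_scale +%R.
Proof. by move=> c f g; apply/funext => a; exact: mulrDr. Qed.
Let scaleDl f : {morph series_scale^~ f : c d / c + d}.
Proof. by move=> c d; apply/funext => a; exact: mulrDl. Qed.
HB.instance Definition _ := GRing.Zmodule_isLmodule.Build k series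
  scaleA scale1 scaleDr scaleDl.

Lemma seriesZE c (f : series) a : (c *: f) a = c * f a. Proof. by []. Qed.
Lemma seriesME (f g : series) a :
  (f * g) a = \sum_(p \in [set p : G * G | p.1 + p.2 = a]) f p.1 * g p.2.
Proof. by []. Qed.
Lemma series1E a : (1 : series) a = (a == 0)%:R. Proof. by []. Qed.

Let scaleAl c (f g : series) : c *: (f * g) = (c *: f) * g.
Proof.
apply/funext => a; change (c * series_mul f g a = series_mul (c *: f) g a).
rewrite !series_mulE_div mulr_sumr.
apply: eq_bigr => b _; rewrite mulr_sumr; apply: eq_bigr => d _.
by case: ifP; rewrite ?mulr0 ?mulrA.
Qed.
HB.instance Definition _ := GRing.Lmodule_isLalgebra.Build k series scaleAl.
HB.instance Definition _ := GRing.Lalgebra_isComAlgebra.Build k series.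

End Series.

Section Decompositions.
Context (H : addFiniteType).

(* All pairs of sequences whose termwise sum is s. *)
Fixpoint decs (s : seq H) : seq (seq H * seq H) :=
  if s is g :: s' then
    [seq (p.1 :: l.1, p.2 :: l.2)
       | p <- fset_set [set p : H * H | p.1 + p.2 = g], l <- decs s']
  else [:: ([::], [::])].

Lemma mem_decomp (g : H) p :
  (p \in fset_set [set p : H * H | p.1 + p.2 = g]) = (p.1 + p.2 == g).
Proof.
rewrite in_fset_set; last exact: finite_decomp.
by apply/idP/eqP; rewrite inE.
Qed.

Lemma mem_decs_cons g s a a' :
  (a, a') \in decs (g :: s) ->
  exists b c b' c', [/\ a = b :: b', a' = c :: c', b + c = g
                      & (b', c') \in decs s].
Proof.
move=> /allpairsP[[[b c] [b' c']] /= [+ l [-> ->]]].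
by rewrite mem_decomp => /eqP bc; exists b, c, b', c'.
Qed.

Lemma size_decs s l : l \in decs s -> size l.1 = size s /\ size l.2 = size s.
Proof.
elim: s l => [|g s IH] [a a']; first by rewrite inE => /eqP[-> ->].
by case/mem_decs_cons => b [c [b' [c' [-> -> _ /IH[/= -> ->]]]]].
Qed.

Lemma uniq_decs s : uniq (decs s).
Proof.
elim: s => //= g s IH; apply: allpairs_uniq => //; first exact: fset_uniq.
by move=> [[b c] [b' c']] [[d e] [d' e']] _ _ /= [-> -> -> ->].
Qed.

Lemma mem_decs_map (X : eqType) (xs : seq X) (f g h : X -> H) :
  reflect {in xs, forall x, f x + g x = h x}
          ((map f xs, map g xs) \in decs (map h xs)).
Proof.
elim: xs => [|x xs IH]; first by rewrite /= inE eqxx; constructor.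
apply: (iffP idP) => [|fg].
  case/mem_decs_cons => b [c [b' [c' [[<- <-] [<- <-] bc /IH fg]]]] y.
  by rewrite inE => /orP[/eqP ->|/fg].
apply/allpairsP; exists ((f x, g x), (map f xs, map g xs)); split=> //=.
  by rewrite mem_decomp /= fg ?mem_head.
by apply/IH => y yxs; apply: fg; rewrite inE yxs orbT.
Qed.

End Decompositions.

Lemma addE_eq0 (E : exponentType) (a b : E) :
  (a + b == 0) = (a == 0) && (b == 0).
Proof.
apply/idP/andP => [ab|[/eqP-> /eqP->]]; last by rewrite addr0.
have [a0|a0] := eqVneq a 0; first by move: ab; rewrite a0 add0r.
have [b0|b0] := eqVneq b 0; first by move: ab; rewrite b0 addr0 (negPf a0).
by have := add_neq0 a b a0 b0; rewrite ab.
Qed.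

Section FfunExponents.
Context (I : finType).

Let ffun_finite_decomp (E : addFiniteType) (f : {ffun I -> E}) :
  finite_set [set p : {ffun I -> E} * {ffun I -> E} | p.1 + p.2 = f].
Proof.
pose mk (l : seq E) : {ffun I -> E} := [ffun i => nth 0 l (index i (enum I))].
pose g (l : seq E * seq E) := (mk l.1, mk l.2).
have mkE (h : {ffun I -> E}) : mk (map h (enum I)) = h.
  apply/ffunP => i; rewrite ffunE (nth_map i) ?index_mem ?mem_enum //.
  by rewrite nth_index ?mem_enum.
apply: (sub_finite_set (B := g @` [set` decs (map f (enum I))])); last first.
  exact/finite_image/finite_seq.
move=> [a b] /= abf; exists (map a (enum I), map b (enum I)).
  by apply/mem_decs_map => i _; rewrite -abf ffunE.
by rewrite /g !mkE.
Qed.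
HB.instance Definition _ (E : addFiniteType) :=
  isAddFinite.Build {ffun I -> E} (@ffun_finite_decomp E).

Let ffun_add_neq0 (E : exponentType) (f g : {ffun I -> E}) :
  f != 0 -> g != 0 -> f + g != 0.
Proof.
move=> f0 _; apply: contra f0 => /eqP fg; apply/eqP/ffunP => i; rewrite ffunE.
have := congr1 (fun h : {ffun I -> E} => h i) fg; rewrite !ffunE => /eqP.
by rewrite addE_eq0 => /andP[/eqP].
Qed.
HB.instance Definition _ (E : exponentType) :=
  AddFinite_isExponent.Build {ffun I -> E} (@ffun_add_neq0 E).

End FfunExponents.

(* Monomials with exponents in E in the variables X; the product of monomials
   is the addition of their exponents, whence the additive notation. *)
Definition monomial (X : choiceType) (E : exponentType) :=
  {fsfun X -> E with 0}.

Section Monomial.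
Context (X : choiceType) (E : exponentType).
Local Notation mono := (monomial X E).

HB.instance Definition _ := Choice.on mono.

Definition mono0 : mono := [fsfun].
Definition mono_add (u v : mono) : mono :=
  [fsfun x in (finsupp u `|` finsupp v)%fset => (u x + v x)%R].

Lemma monoP (u v : mono) : u =1 v -> u = v.
Proof. by move=> uv; apply/fsfunP. Qed.

Lemma mono_addE u v x : mono_add u v x = u x + v x.
Proof.
rewrite fsfunE; case: ifPn => //.
by rewrite inE negb_or !memNfinsupp => /andP[/eqP-> /eqP->]; rewrite addr0.
Qed.

Let addA : associative mono_add.
Proof. by move=> u v w; apply: monoP => x; rewrite !mono_addE addrA. Qed.
Let addC : commutative mono_add.
Proof. by move=> u v; apply: monoP => x; rewrite !mono_addE addrC. Qed.
Let add0 : left_id mono0 mono_add.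
Proof.
by move=> u; apply: monoP => x; rewrite mono_addE fsfun0E add0r.
Qed.
HB.instance Definition _ := GRing.isNmodule.Build mono addA addC add0.

Lemma monoDE (u v : mono) x : (u + v) x = u x + v x.
Proof. exact: mono_addE. Qed.

Lemma mono0E x : (0 : mono) x = 0.
Proof. exact: fsfun0E. Qed.

Lemma mono_sumE I (r : seq I) (P : pred I) (F : I -> mono) x :
  (\sum_(i <- r | P i) F i) x = \sum_(i <- r | P i) F i x.
Proof. by elim/big_rec2: _ => [|i y1 y2 _ <-]; rewrite ?mono0E ?monoDE. Qed.

Let mono_finite_decomp (u : mono) :
  finite_set [set p : mono * mono | p.1 + p.2 = u].
Proof.
pose s := enum_fset (finsupp u).
pose mk (l : seq E) : mono := [fsfun x in finsupp u => nth 0 l (index x s)].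
pose g (l : seq E * seq E) := (mk l.1, mk l.2).
have mkE (v : mono) : (forall x, x \notin finsupp u -> v x = 0) ->
    mk (map v s) = v.
  move=> v0; apply: monoP => x; rewrite /mk fsfunE.
  case: ifPn => [xu|/v0-> //].
  by rewrite (nth_map x) ?index_mem // nth_index.
apply: (sub_finite_set (B := g @` [set` decs (map u s)])); last first.
  exact/finite_image/finite_seq.
move=> [a b] /= abu.
have ab0 x : x \notin finsupp u -> a x = 0 /\ b x = 0.
  rewrite memNfinsupp -abu monoDE addE_eq0.
  by case/andP => /eqP-> /eqP->.
exists (map a s, map b s).
  by apply/mem_decs_map => x _; rewrite -abu monoDE.
by rewrite /g !mkE // => x /ab0[].
Qed.
HB.instance Definition _ := isAddFinite.Build mono mono_finite_decomp.

End Monomial.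

Section QuasiMonomial.
Context (k : comNzRingType) (m : nat) (E : exponentType).

(* The variable x_{i,j} is the pair (i, j); the indices i in [m] and j in
   {1, 2, ...} are both shifted to start at 0. *)
Local Notation mono := (monomial ('I_m * nat)%type E).
Local Notation mexp := {ffun 'I_m -> E}.

Definition xpow (j : nat) (w : mexp) : mono :=
  [fsfun x in [fset (i, j) | i in 'I_m]%fset => w x.1].

(* The infinite sum is taken coefficientwise: the coefficient at u counts the
   sequences j_1 < ... < j_n with x_{j_1}^{w_1} ... x_{j_n}^{w_n} = u. *)
Definition qmonomial (w : seq mexp) : series k mono := fun u =>
  \sum_(j \in [set j : (size w).-tuple nat | sorted ltn j])
     ((\sum_(i < size w) xpow (tnth j i) w`_i == u)%:R : k).

Lemma xpowE j w i p : xpow j w (i, p) = if p == j then w i else 0.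
Proof.
rewrite fsfunE; case: imfsetP => [[i' _ /= [-> ->]]|]; first by rewrite eqxx.
by case: eqP => // -> []; exists i.
Qed.

Definition col (u : mono) (p : nat) : mexp := [ffun i => u (i, p)].

Lemma col_ext u v : col u =1 col v -> u = v.
Proof.
move=> uv; apply: monoP => -[i p].
by have := congr1 (fun f : mexp => f i) (uv p); rewrite !ffunE.
Qed.

Lemma colD u v p : col (u + v) p = col u p + col v p.
Proof. by apply/ffunP => i; rewrite !ffunE monoDE. Qed.

Lemma col_sum n (j : 'I_n -> nat) (w : 'I_n -> mexp) p :
  col (\sum_(i < n) xpow (j i) (w i)) p =
  \sum_(i < n) (if p == j i then w i else 0).
Proof.
apply/ffunP => i; rewrite ffunE mono_sumE sum_ffunE; apply: eq_bigr => l _.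
by rewrite xpowE; case: eqP => _ //; rewrite ffunE.
Qed.

Lemma sum_index (J : seq nat) (w : seq mexp) p : uniq J -> size J = size w ->
  \sum_(i < size w) (if p == nth 0%N J i then w`_i else 0) =
  if p \in J then w`_(index p J) else 0.
Proof.
move=> uJ sJ; case: ifPn => pJ; last first.
  rewrite big1 // => i _; case: eqP => // pi; case/negP: pJ.
  by rewrite pi mem_nth // sJ.
have lti : (index p J < size w)%N by rewrite -sJ index_mem.
rewrite (bigD1 (Ordinal lti)) //= nth_index // eqxx big1 ?addr0 // => i.
rewrite -val_eqE /= => ne; case: eqP => // pi; case/eqP: ne.
by rewrite pi index_uniq // sJ.
Qed.

Definition cols (N : nat) (u : mono) := [seq col u p | p <- iota 0 N].
Definition pack (N : nat) (u : mono) := [seq g <- cols N u | g != 0].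
Definition bounded (N : nat) (u : mono) := forall p, (N <= p)%N -> col u p = 0.

Lemma boundedP u : exists N, bounded N u.
Proof.
exists (\max_(x <- finsupp u) x.2).+1%N => p lep; apply/ffunP => i.
rewrite !ffunE; apply: contraTeq lep; rewrite -ltnNge ltnS => ux.
have xu : (i, p) \in finsupp u by rewrite mem_finsupp.
by rewrite (big_fsetD1 _ xu) /= leq_maxl.
Qed.

Lemma qmonomialE N (w : seq mexp) u : 0 \notin w -> bounded N u ->
  qmonomial w u = (pack N u == w)%:R.
Proof.
move=> w0 uN; pose J0 := [seq p <- iota 0 N | col u p != 0].
have packE : pack N u = map (col u) J0 by rewrite /pack /cols filter_map.
have sJ0 : sorted ltn J0.
  by apply: sorted_filter (iota_ltn_sorted 0 N); exact: ltn_trans.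
have nth0 i : (i < size w)%N -> w`_i != 0.
  by move=> iw; apply: contraNneq w0 => <-; rewrite mem_nth.
have only_j0 (j : (size w).-tuple nat) : sorted ltn j ->
    \sum_(i < size w) xpow (tnth j i) w`_i = u ->
    J0 = j /\ map (col u) J0 = w.
  move=> sj ju; have uj : uniq j.
    by apply: sorted_uniq sj; [exact: ltn_trans|exact: ltnn].
  have cE p : col u p = if p \in val j then w`_(index p j) else 0.
    rewrite -ju (col_sum (tnth j) (fun i => w`_i)) -sum_index ?size_tuple //.
    by apply: eq_bigr => i _; rewrite (tnth_nth 0%N).
  have jE p : (p \in val j) = (col u p != 0).
    rewrite cE; case: ifP => pj; last by rewrite eqxx.
    by rewrite nth0 // -{2}(size_tuple j) index_mem.
  have Jj : J0 = j.
    apply: (irr_sorted_eq ltn_trans ltnn) => // p.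
    rewrite mem_filter -jE andb_idr // => pj; rewrite mem_iota /= add0n ltnNge.
    by move: pj; rewrite jE; apply: contra => /uN->.
  split=> //; rewrite Jj; apply: (@eq_from_nth _ 0).
    by rewrite size_map size_tuple.
  move=> i; rewrite size_map => ij; rewrite (nth_map 0%N) // cE mem_nth //.
  by rewrite index_uniq.
rewrite packE /qmonomial; case: eqP => [Jw|nJ]; last first.
  rewrite fsbig1 // => j /= sj; case: eqP => // /only_j0 -/(_ sj)[_ Jw].
  by case: nJ.
have szJ : size J0 == size w by rewrite -Jw size_map.
pose j0 := Tuple szJ.
have j0u : \sum_(i < size w) xpow (tnth j0 i) w`_i = u.
  apply: col_ext => p; rewrite (col_sum (tnth j0) (fun i => w`_i)).
  transitivity (if p \in J0 then w`_(index p J0) else 0).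
    rewrite -sum_index ?(eqP szJ) //; last first.
      by apply: sorted_uniq sJ0; [exact: ltn_trans|exact: ltnn].
    by apply: eq_bigr => i _; rewrite (tnth_nth 0%N).
  case: ifPn => [pJ|].
    by rewrite -{1}Jw (nth_map 0%N) ?index_mem // nth_index.
  rewrite mem_filter negb_and negbK mem_iota /= add0n -leqNgt.
  by case/orP => [/eqP->//|/uN->].
transitivity (\sum_(j \in [set j0])
    ((\sum_(i < size w) xpow (tnth j i) w`_i == u)%:R : k)); last first.
  by rewrite fsbig_set1 j0u eqxx.
apply/esym/fsbig_widen => [j /= -> //|j [/= sj nj]].
case: eqP => // /(only_j0 _ sj)[Jj _]; case: nj; apply: val_inj.
by rewrite /= Jj.
Qed.

Fixpoint qshuffle (u : seq mexp) : seq mexp -> seq (seq mexp) :=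
  if u is a :: u' then
    fix qshuffle_u (v : seq mexp) : seq (seq mexp) :=
      if v is b :: v' then
        map (cons a) (qshuffle u' v) ++ map (cons b) (qshuffle_u v')
          ++ map (cons (a + b)) (qshuffle u' v')
      else [:: u]
  else fun v => [:: v].

Lemma qshuffle_cons a u b v : qshuffle (a :: u) (b :: v) =
  map (cons a) (qshuffle u (b :: v)) ++ map (cons b) (qshuffle (a :: u) v)
    ++ map (cons (a + b)) (qshuffle u v).
Proof. by []. Qed.

Lemma qshuffle0s v : qshuffle [::] v = [:: v]. Proof. by []. Qed.
Lemma qshuffles0 u : qshuffle u [::] = [:: u]. Proof. by case: u. Qed.
Arguments qshuffle : simpl never.

Lemma qshuffle_neq0 (u v w : seq mexp) : 0 \notin u -> 0 \notin v ->
  w \in qshuffle u v -> 0 \notin w.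
Proof.
elim: u v w => [|a u IHu] v w; first by move=> _ v0; rewrite inE => /eqP->.
elim: v w => [|b v IHv] w; first by move=> u0 _; rewrite inE => /eqP->.
move=> u0 v0; have := u0; have := v0; rewrite !in_cons !negb_or.
move=> /andP[b0 v0'] /andP[a0 u0'].
rewrite qshuffle_cons !mem_cat => /or3P[] /mapP[w' ww' ->];
  rewrite in_cons negb_or.
- by rewrite a0 (IHu _ _ _ v0 ww').
- by rewrite b0 (IHv _ u0 v0' ww').
- by rewrite eq_sym add_neq0 1?eq_sym // (IHu _ _ _ v0' ww').
Qed.

Lemma sum_decomp_eq (g : mexp) q (c : k) :
  \sum_(p <- fset_set [set p : mexp * mexp | p.1 + p.2 = g]) (p == q)%:R * c =
  (q.1 + q.2 == g)%:R * c.
Proof.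
rewrite -mulr_suml; congr (_ * _); rewrite -mem_decomp.
set D := fset_set _; case: (boolP (q \in D)) => qD.
  rewrite (big_fsetD1 _ qD) /= eqxx big1_fset ?addr0 // => p.
  by rewrite !inE => /andP[/negPf->].
by rewrite big1_fset // => p pD _; case: eqP qD => // <-; rewrite pD.
Qed.

Lemma sum_decs (s u v : seq mexp) : 0 \notin u -> 0 \notin v ->
  \sum_(l <- decs s) ([seq g <- l.1 | g != 0] == u)%:R
                     * ([seq g <- l.2 | g != 0] == v)%:R
  = (count_mem [seq g <- s | g != 0] (qshuffle u v))%:R :> k.
Proof.
elim: s u v => [|g s IH] u v u0 v0.
  rewrite /= big_seq1 /=; case: u u0 => [|a u] _.
    by rewrite qshuffle0s /= eq_sym mul1r addn0.
  rewrite mul0r; case: v v0 => [|b v] _; first by rewrite qshuffles0.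
  rewrite qshuffle_cons !count_cat !count_map /=.
  by rewrite !(eq_count (a2 := pred0)) // !count_pred0.
rewrite /= big_allpairs_dep; have [->|g0] := eqVneq g 0.
  have -> : fset_set [set p : mexp * mexp | p.1 + p.2 = 0] = [fset (0, 0)]%fset.
    apply/fsetP => -[x y]; rewrite mem_decomp addE_eq0 inE.
    by rewrite -pair_eqE.
  rewrite big_seq_fset1 /= eqxx /= -IH //.
pose F (u v : seq mexp) : k := \sum_(l <- decs s)
  ([seq g <- l.1 | g != 0] == u)%:R * ([seq g <- l.2 | g != 0] == v)%:R.
have pne0 p : p \in fset_set [set p : mexp * mexp | p.1 + p.2 = g] ->
    ~~ ((p.1 == 0) && (p.2 == 0)).
  by rewrite mem_decomp -addE_eq0 => /eqP->.
pose T (u v : seq mexp) (p : mexp * mexp) : k := \sum_(l <- decs s)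
  ([seq g <- p.1 :: l.1 | g != 0] == u)%:R
  * ([seq g <- p.2 :: l.2 | g != 0] == v)%:R.
rewrite [LHS](_ : _ =
  \sum_(p <- fset_set [set p : mexp * mexp | p.1 + p.2 = g]) T u v p) //.
have T00 p : T [::] [::] p = ((p.1 == 0) && (p.2 == 0))%:R * F [::] [::].
  rewrite /T /=; case: eqP => [_|_] /=; case: eqP => [_|_] /=;
    by rewrite ?mul1r // [RHS]mul0r big1 // => l _; rewrite ?mul0r ?mulr0.
have T01 b v' p : b != 0 -> ~~ ((p.1 == 0) && (p.2 == 0)) ->
    T [::] (b :: v') p = (p == (0, b))%:R * F [::] v'.
  case: p => x y b0; rewrite /T /= xpair_eqE.
  case: eqP => [_|_] /=; last by rewrite mul0r big1 // => l _; rewrite mul0r.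
  move=> -> /=; rewrite /F mulr_sumr; apply: eq_bigr => l _.
  by rewrite eqseq_cons -mulnb natrM mulrCA.
have T10 a u' p : a != 0 -> ~~ ((p.1 == 0) && (p.2 == 0)) ->
    T (a :: u') [::] p = (p == (a, 0))%:R * F u' [::].
  case: p => x y a0; rewrite /T /= xpair_eqE andbC [(x == a) && _]andbC.
  case: (y =P 0) => [_|_] /=; last first.
    by rewrite mul0r big1 // => l _; rewrite mulr0.
  move=> -> /=; rewrite /F mulr_sumr; apply: eq_bigr => l _.
  by rewrite eqseq_cons -mulnb natrM mulrA.
have T11 a u' b v' p : a != 0 -> b != 0 -> ~~ ((p.1 == 0) && (p.2 == 0)) ->
    T (a :: u') (b :: v') p = (p == (a, 0))%:R * F u' (b :: v')
    + (p == (0, b))%:R * F (a :: u') v' + (p == (a, b))%:R * F u' v'.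
  case: p => x y a0 b0; rewrite /T /= !xpair_eqE.
  have [->|x0] := eqVneq x 0 => /=.
    move=> y0; rewrite y0 [0 == a]eq_sym (negPf a0) !mul0r add0r addr0.
    rewrite /F mulr_sumr; apply: eq_bigr => l _.
    by rewrite eqseq_cons -mulnb natrM mulrCA.
  have [->|y0] := eqVneq y 0 => /= _.
    rewrite [0 == b]eq_sym (negPf b0) andbT andbF !mul0r !addr0.
    rewrite /F mulr_sumr; apply: eq_bigr => l _.
    by rewrite eqseq_cons -mulnb natrM mulrA.
  rewrite andbF !mul0r !add0r /F mulr_sumr; apply: eq_bigr => l _.
  by rewrite !eqseq_cons -!mulnb !natrM mulrACA.
rewrite /=.
case: u u0 => [|a u] u0; case: v v0 => [|b v] v0.
- rewrite big_seq big1 => [|p /pne0]; first by rewrite qshuffle0s.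
  by rewrite T00; case: (_ && _) => //; rewrite mul0r.
- have [b0 v0'] : b != 0 /\ 0 \notin v.
    by move: v0; rewrite inE negb_or eq_sym => /andP.
  rewrite big_seq; under eq_bigr => p /pne0 pn do rewrite T01 //.
  rewrite -big_seq sum_decomp_eq /= add0r /F IH // !qshuffle0s /=.
  by rewrite !addn0 -natrM mulnb eqseq_cons.
- have [a0 u0'] : a != 0 /\ 0 \notin u.
    by move: u0; rewrite inE negb_or eq_sym => /andP.
  rewrite big_seq; under eq_bigr => p /pne0 pn do rewrite T10 //.
  rewrite -big_seq sum_decomp_eq /= addr0 /F IH // !qshuffles0 /=.
  by rewrite !addn0 -natrM mulnb eqseq_cons.
have [b0 v0'] : b != 0 /\ 0 \notin v.
  by move: v0; rewrite inE negb_or eq_sym => /andP.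
have [a0 u0'] : a != 0 /\ 0 \notin u.
  by move: u0; rewrite inE negb_or eq_sym => /andP.
rewrite big_seq; under eq_bigr => p /pne0 pn do rewrite T11 //.
rewrite -big_seq !big_split /= !sum_decomp_eq /= addr0 add0r /F !IH //.
rewrite qshuffle_cons !count_cat !natrD !addrA -!natrM.
have cm x w (L : seq (seq mexp)) : ((x == g) * count_mem w L)%N =
    count_mem (g :: w) (map (cons x) L).
  rewrite count_map; case: eqP => [->|xg].
    by rewrite mul1n; apply: eq_count => z /=; rewrite eqseq_cons eqxx.
  rewrite mul0n; apply/esym/eqP; rewrite -leqn0 leqNgt -has_count; apply/hasPn.
  by move=> z _ /=; rewrite eqseq_cons; case: eqP => // /xg.
by rewrite !cm.
Qed.

Lemma nth_cols N u p : (p < N)%N -> (cols N u)`_p = col u p.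
Proof. by move=> pN; rewrite (nth_map 0%N) ?size_iota // nth_iota. Qed.

Lemma qmonomialM (u v : seq mexp) : 0 \notin u -> 0 \notin v ->
  qmonomial u * qmonomial v = \sum_(w <- qshuffle u v) qmonomial w.
Proof.
move=> u0 v0; apply/funext => a; have [N aN] := boundedP a.
rewrite seriesME series_sumE.
have -> : \sum_(w <- qshuffle u v) qmonomial w a =
          (count_mem (pack N a) (qshuffle u v))%:R.
  rewrite -sum1_count natr_sum [RHS]big_mkcond /=.
  apply: eq_big_seq => w /(qshuffle_neq0 u0 v0) w0.
  by rewrite (qmonomialE w0 aN) eq_sym; case: eqP.
rewrite -sum_decs //.
pose D := fset_set [set p : mono * mono | p.1 + p.2 = a].
pose f (p : mono * mono) := (cols N p.1, cols N p.2).
have pN p : p \in D -> bounded N p.1 /\ bounded N p.2.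
  rewrite mem_decomp => /eqP pa; split=> q /aN; rewrite -pa colD => /eqP;
  by rewrite addE_eq0 => /andP[/eqP ? /eqP ?].
have -> : \sum_(p \in [set p : mono * mono | p.1 + p.2 = a])
            qmonomial u p.1 * qmonomial v p.2 =
  \sum_(l <- [seq f p | p <- D]) ([seq g <- l.1 | g != 0] == u)%:R
                     * ([seq g <- l.2 | g != 0] == v)%:R.
  rewrite fsbig_finite; last exact: finite_decomp.
  rewrite big_map; apply: eq_big_seq => p /pN[p1 p2].
  by rewrite (qmonomialE u0 p1) (qmonomialE v0 p2).
apply: perm_big; apply: uniq_perm; last 1 first.
- case=> b c; apply/mapP/idP => [[p pD [-> ->]]|bc].
    apply/mem_decs_map => q _; rewrite -colD.
    by move: pD; rewrite mem_decomp => /eqP->.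
  have [/= sb sc] := size_decs bc; rewrite size_map size_iota in sb sc.
  pose mk (l : seq mexp) : mono := \sum_(i < size l) xpow i l`_i.
  have mkE l p : col (mk l) p = l`_p.
    rewrite (col_sum (fun i => val i) (fun i => l`_i)).
    have [pl|lp] := ltnP p (size l); last first.
      rewrite nth_default // big1 // => i _; case: eqP => // pi.
      by move: lp; rewrite pi leqNgt ltn_ord.
    rewrite (bigD1 (Ordinal pl)) //= eqxx big1 ?addr0 // => i.
    by rewrite -val_eqE /= eq_sym => /negPf->.
  have colsE l : size l = N -> cols N (mk l) = l.
    move=> sl; apply: (@eq_from_nth _ 0); rewrite size_map size_iota // => i iN.
    by rewrite nth_cols // mkE.
  exists (mk b, mk c); last by rewrite /f /= !colsE.
  rewrite mem_decomp /=; apply/eqP/col_ext => p; rewrite colD.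
  have [pN'|Np] := ltnP p N; last first.
    by rewrite !mkE !nth_default ?sb ?sc // addr0 aN.
  have /mem_decs_map H : (cols N (mk b), cols N (mk c)) \in decs (cols N a).
    by rewrite !colsE.
  by rewrite H // mem_iota.
- rewrite map_inj_in_uniq ?fset_uniq // => -[b c] [b' c'].
  move=> /pN[/= bN cN] /pN[/= bN' cN'] [eb ec]; congr pair; apply: col_ext => p.
    have [pN'|Np] := ltnP p N; last by rewrite bN // bN'.
    by rewrite -(nth_cols b pN') eb nth_cols.
  have [pN'|Np] := ltnP p N; last by rewrite cN // cN'.
  by rewrite -(nth_cols c pN') ec nth_cols.
- exact: uniq_decs.
Qed.

Lemma qmonomial_nil : qmonomial [::] = 1.
Proof.
apply/funext => a; have [N aN] := boundedP a.
rewrite (qmonomialE _ aN) // series1E; congr (_%:R); apply: congr1.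
apply/eqP/eqP => [pa|->].
  apply: col_ext => p; have [pN|Np] := ltnP p N; last first.
    by rewrite aN //; apply/ffunP => i; rewrite !ffunE mono0E.
  apply/eqP; rewrite -[_ == _]negbK; apply/negP => ap.
  suff : col a p \in pack N a by rewrite pa.
  rewrite mem_filter map_f ?mem_iota // andbT; apply: contra ap => /eqP->.
  by apply/eqP/ffunP => i; rewrite !ffunE mono0E.
apply/eqP; rewrite -size_eq0 size_filter -leqn0 leqNgt -has_count.
apply/hasPn => _ /mapP[p _ ->]; rewrite negbK; apply/eqP/ffunP => i.
by rewrite !ffunE mono0E.
Qed.

End QuasiMonomial.

Section MultiComposition.
Context (m : nat) (E : exponentType).
Local Notation mexp := {ffun 'I_m -> E}.

Record multicomp := MultiComp { mcseq :> seq mexp; _ : 0 \notin mcseq }.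
HB.instance Definition _ := [isSub for mcseq].
HB.instance Definition _ := [Choice of multicomp by <:].
Implicit Types (w : multicomp) (L : seq nat).

Lemma mc_neq0 w : 0 \notin (w : seq mexp). Proof. by case: w. Qed.

Definition mc_nil : multicomp := @MultiComp [::] isT.

Lemma mc_take_subproof i w : 0 \notin take i w.
Proof. by apply/negP => /mem_take; apply/negP; exact: mc_neq0. Qed.
Definition mc_take i w := MultiComp (mc_take_subproof i w).

Lemma mc_drop_subproof i w : 0 \notin drop i w.
Proof. by apply/negP => /mem_drop; apply/negP; exact: mc_neq0. Qed.
Definition mc_drop i w := MultiComp (mc_drop_subproof i w).

Lemma mc_rev_subproof w : 0 \notin rev w.
Proof. by rewrite mem_rev mc_neq0. Qed.
Definition mc_rev w := MultiComp (mc_rev_subproof w).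

Definition composition_of (n : nat) (L : seq nat) : bool :=
  (0%N \notin L) && (sumn L == n).

Definition coarsen L (u : seq mexp) : seq mexp :=
  [seq \sum_(v <- b) v | b <- reshape L u].

Lemma coarsen_neq0 L u : composition_of (size u) L -> 0 \notin u ->
  0 \notin coarsen L u.
Proof.
elim: L u => [//|l L IH] u; rewrite /composition_of /= inE negb_or.
case/andP => /andP[l0 L0] /eqP sz u0; rewrite inE negb_or.
have u0' : 0 \notin drop l u by apply/negP => /mem_drop; apply/negP.
rewrite IH // ?andbT; last first.
  by rewrite /composition_of L0 size_drop -sz addKn eqxx.
case: u sz u0 {u0'} => [|a u] /= sz; first by move: l0; case: (l) sz.
rewrite inE negb_or => /andP[a0 _]; case: l l0 {sz} => // l _ /=.
by rewrite big_cons eq_sym addE_eq0 eq_sym (negPf a0).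
Qed.

(* The multi-composition L o w; only meaningful when L is a composition of the
   length of w, see mc_coarsenE. *)
Definition mc_coarsen L w : multicomp := insubd mc_nil (coarsen L w).

Lemma mc_coarsenE L w : composition_of (size w) L ->
  mc_coarsen L w = coarsen L w :> seq mexp.
Proof.
by move=> Lw; rewrite /mc_coarsen val_insubd (coarsen_neq0 Lw) ?mc_neq0.
Qed.

Lemma finite_composition n : finite_set [set L | composition_of n L].
Proof.
apply: (sub_finite_set (B := (map (@nat_of_ord n.+1)) @`
    (val @` [set: {bseq n of 'I_n.+1}]))); last first.
  by do 2!apply: finite_image; exact: finite_finset.
move=> L /andP[L0 /eqP sL].
have szL : (size L <= n)%N.
  rewrite -sL; elim: L L0 {sL} => //= l L IH; rewrite inE negb_or.
  case: l => // l /IH; rewrite addSn ltnS => /leq_trans-> //.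
  exact: leq_addl.
have leL l : l \in L -> (l < n.+1)%N.
  rewrite ltnS -sL; elim: (L) => //= l' L' IH; rewrite inE => /orP[/eqP->|/IH].
    exact: leq_addr.
  by move/leq_trans; apply; exact: leq_addl.
have sz' : (size (map (@inord n) L) <= n)%N by rewrite size_map.
exists (map inord L); first by exists (Bseq sz').
rewrite -map_comp map_id_in // => l /leL ln /=; exact: inordK.
Qed.

End MultiComposition.

Arguments mc_nil {m E}.

Section MQSym.
Context (k : comNzRingType) (m : nat) (E : exponentType).
Local Notation mono := (monomial ('I_m * nat)%type E).
Local Notation multicomp := (multicomp m E).

Definition MQSym_pred : {pred series k mono} :=
  kspanp (range (fun w : multicomp => qmonomial k w)).

Lemma qmonomial_MQSym (w : multicomp) : qmonomial k w \in MQSym_pred.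
Proof. by apply: kspan_gen; exists w. Qed.

Lemma MQSym_subalg : subalg_closed MQSym_pred.
Proof.
split; first by rewrite -qmonomial_nil; exact: (qmonomial_MQSym mc_nil).
  by move=> a f g fM gM; rewrite rpredD // rpredZ.
move=> f g fM gM; move: f fM; apply: kspan_ind => [|a f f' [u _ <-] IH].
  by rewrite mul0r rpred0.
rewrite mulrDl rpredD // -scalerAl rpredZ // {IH}.
move: g gM; apply: kspan_ind => [|b g g' [v _ <-] IHg].
  by rewrite mulr0 rpred0.
rewrite mulrDr rpredD // -scalerAr rpredZ // qmonomialM ?mc_neq0 //.
rewrite big_seq rpred_sum // => w /qshuffle_neq0 w0.
exact: (qmonomial_MQSym (MultiComp (w0 (mc_neq0 u) (mc_neq0 v)))).
Qed.
HB.instance Definition _ :=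
  GRing.isSubalgClosed.Build k (series k mono) MQSym_pred MQSym_subalg.

Record MQSym := MkMQSym { MQSym_series :> series k mono;
                          _ : MQSym_series \in MQSym_pred }.
HB.instance Definition _ := [isSub for MQSym_series].
HB.instance Definition _ := [Choice of MQSym by <:].
HB.instance Definition _ := [SubChoice_isSubAlgebra of MQSym by <:].
HB.instance Definition _ := [SubNzRing_isSubComNzRing of MQSym by <:].

Definition MQSym_M (w : multicomp) : MQSym := MkMQSym (qmonomial_MQSym w).

End MQSym.

(* Main.v *)
(* The quasi-monomials M_w are a basis because M_v has coefficient [v = w] at
   the leading monomial x_1^(w_1) ... x_n^(w_n) of M_w, so the structure maps can
   be defined and all axioms checked on words. Deconcatenation is compatible with
   the quasi-shuffle product by comparing first letters. For the left antipode
   identity, split each product M_x M_v, with x a coarsening of the reversal of a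
   prefix of w and v the corresponding suffix, according to whether the first
   letter of the result involves the first letter of v: the terms where it does
   cancel the terms of the next prefix where it does not. The right identity then
   holds because a left convolution inverse of a function f on words with f of
   the empty word equal to 1 is also a right inverse. *)
From HB Require Import structures.
Require Import Defs.
From mathcomp Require Import all_boot all_order all_algebra.
From mathcomp Require Import finmap ssrAC.
From mathcomp Require Import boolp classical_sets fsbigop.

Set Implicit Arguments.
Unset Strict Implicit.
Unset Printing Implicit Defensive.

Import GRing.Theory.
Local Open Scope classical_set_scope.
Local Open Scope ring_scope.

(** * Deconcatenation of words *)

Section Cuts.
Context (T : Type).
Implicit Types (s : seq T).

(** Recursion on the first letter replaces the index of the cut, so that identities between sums
    over cuts follow by induction on the word; [cutsE] recovers the indexed form. *)
Fixpoint cuts s : seq (seq T * seq T) :=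
  if s is a :: s' then ([::], s) :: [seq (a :: p.1, p.2) | p <- cuts s']
  else [:: ([::], [::])].

Lemma cutsE s : cuts s = [seq (take i s, drop i s) | i <- iota 0 (size s).+1].
Proof.
elim: s => // a s IH; rewrite [LHS]/= IH.
rewrite -[iota 0 _ in RHS]/(0%N :: iota (1 + 0) (size s).+1) iotaDl map_cons.
by rewrite -!map_comp.
Qed.

(** Both sides run over the factorisations of [s] into three words. This is coassociativity on
    words; [F] is arbitrary so that it can absorb the first letter in the induction. *)
Lemma big_cuts_coassoc (V : nmodType) (F : seq T -> seq T -> seq T -> V) s :
  \sum_(p <- cuts s) \sum_(q <- cuts p.1) F q.1 q.2 p.2 =
  \sum_(p <- cuts s) \sum_(q <- cuts p.2) F p.1 q.1 q.2.
Proof.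
elim: s F => [|a s IH] F; first by rewrite /= !big_seq1.
rewrite /= !big_cons !big_map big_nil addr0 /=.
under eq_bigr => p _ do rewrite big_cons big_map /=.
by rewrite big_split /= (IH (fun x => F (a :: x))) addrA.
Qed.

End Cuts.

Lemma mem_cuts (T : eqType) (s : seq T) p : p \in cuts s -> p.1 ++ p.2 = s.
Proof. by rewrite cutsE => /mapP[i _ ->]; exact: cat_take_drop. Qed.

Lemma big_cuts_nill (T : eqType) (V : nmodType) (F : seq T -> seq T -> V) s :
  \sum_(p <- cuts s) F p.1 p.2 *+ (p.1 == [::]) = F [::] s.
Proof.
case: s => [|a s]; rewrite /= ?big_seq1 // big_cons big_map.
by rewrite big1 ?addr0.
Qed.

Lemma big_cuts_nilr (T : eqType) (V : nmodType) (F : seq T -> seq T -> V) s :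
  \sum_(p <- cuts s) F p.1 p.2 *+ (p.2 == [::]) = F s [::].
Proof.
elim: s F => [|a s IH] F; rewrite /= ?big_seq1 // big_cons big_map add0r.
exact: (IH (fun x => F (a :: x))).
Qed.

(* In the ring of functions on words under deconcatenation convolution, a left
   inverse [s] of [f] is a right inverse: [s * (f * s) = s], which determines
   [f * s] by induction on the length since [s [::]] is invertible. *)
Lemma cuts_inverse_sym (T : eqType) (A : pzRingType) (f s : seq T -> A)
    (P : pred (seq T)) :
  (forall u v, P (u ++ v) -> P u && P v) ->
  f [::] = 1 -> s [::] = 1 ->
  (forall w, P w -> \sum_(p <- cuts w) s p.1 * f p.2 = (w == [::])%:R) ->
  (forall w, P w -> \sum_(p <- cuts w) f p.1 * s p.2 = (w == [::])%:R).
Proof.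
move=> Pcat f1 s1 sf w; have [n] := ubnP (size w).
elim: n w => // n IH w; rewrite ltnS => wn Pw.
(* The double convolution is evaluated in two ways: grouping [s] with [f] first yields [s w]. *)
have := big_cuts_coassoc (fun x y z => s x * f y * s z) w.
under eq_big_seq => p /mem_cuts pw.
  have /andP[Pp _] : P p.1 && P p.2 by apply: Pcat; rewrite pw.
  rewrite -mulr_suml sf //; over.
under [RHS]eq_bigr => p _.
  under eq_bigr => q _ do rewrite -mulrA.
  rewrite -mulr_sumr; over.
case: w wn Pw => [|a w] wn Pw.
  by rewrite /= !big_seq1 /= f1 s1 !mul1r.
under eq_bigr => p _ do rewrite mulr_natl.
rewrite (big_cuts_nill (fun _ => s)) /= big_cons big_map s1 mul1r.
(* The empty prefix contributes the sum to be computed; once the other prefixes are shown to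
   contribute [s (a :: w)], that sum must vanish. *)
rewrite [X in _ = _ + X -> _](_ : _ = s (a :: w)).
  by move=> /(congr1 (fun x => x - s (a :: w))); rewrite addrK subrr => <-.
(* The remaining suffixes are shorter than [a :: w], so by induction only the empty one
   contributes. *)
rewrite -[RHS](big_cuts_nilr (fun x _ => s (a :: x))).
apply: eq_big_seq => p /mem_cuts pw; rewrite -mulr_natr IH //=.
  by rewrite (leq_trans _ wn) // -pw /= size_cat ltnS leq_addl.
by have /Pcat/andP[] : P ((a :: p.1) ++ p.2) by rewrite /= pw.
Qed.

(** * Compatibility of deconcatenation with the quasi-shuffle product *)

Section QuasiShuffle.
Context (m : nat) (E : exponentType).
Local Notation mexp := {ffun 'I_m -> E}.
Local Arguments qshuffle : simpl never.
Implicit Types u v w : seq mexp.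

(** A cut of a quasi-shuffle restricts to a cut of [u] and one of [v]. In the induction, a cut
    either has an empty left part or has the first letter [a], [b] or [a + b] in its left part, and
    that letter is absorbed into [F]. *)
Lemma big_cuts_qshuffle (V : nmodType) (F : seq mexp -> seq mexp -> V) u v :
  \sum_(w <- qshuffle u v) \sum_(p <- cuts w) F p.1 p.2 =
  \sum_(p <- cuts u) \sum_(q <- cuts v)
    \sum_(x <- qshuffle p.1 q.1) \sum_(y <- qshuffle p.2 q.2) F x y.
Proof.
elim: u v F => [|a u IHu] v F.
  rewrite qshuffle0s /= !big_seq1; apply: eq_bigr => q _.
  by rewrite !qshuffle0s !big_seq1.
elim: v F => [|b v IHv] F.
  rewrite qshuffles0 big_seq1 /=; apply: eq_bigr => p _.
  by rewrite big_seq1 !qshuffles0 !big_seq1.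
rewrite qshuffle_cons !big_cat !big_map /=.
under eq_bigr => w _ do rewrite /= big_cons big_map /=.
under [X in _ + (X + _)]eq_bigr => w _ do rewrite /= big_cons big_map /=.
under [X in _ + (_ + X)]eq_bigr => w _ do rewrite /= big_cons big_map /=.
rewrite !big_split /=.
rewrite (IHu (b :: v) (fun x => F (a :: x))) (IHv (fun x => F (b :: x))).
rewrite (IHu v (fun x => F ((a + b) :: x))).
rewrite /= !big_cons !big_map /=.
rewrite qshuffle_cons !big_cat !big_map big_nil addr0 /=.
under [X in _ + X + _ = _]eq_bigr => p _ do
  rewrite big_cons big_map /= qshuffles0 big_seq1.
under [X in _ = _ + X]eq_bigr => p _.
  rewrite big_cons big_map qshuffles0 big_seq1 /=.
  under [X in _ + X]eq_bigr => q _ do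
    rewrite /= qshuffle_cons !big_cat !big_map /=.
  rewrite !big_split /=; over.
under [X in _ = _ + X + _]eq_bigr => q _ do rewrite qshuffle0s big_seq1.
under [X in _ + (_ + (X + _) + _) = _]eq_bigr => q _ do
  rewrite qshuffle0s big_seq1.
rewrite !big_split /=.
(* Both sides now consist of the same eight sums in different orders. *)
by rewrite [LHS](AC ((1*2)*((1*2)*2)) (1*(4*7)*5*(2*(3*(6*8))))).
Qed.

End QuasiShuffle.

(** * Coarsenings of words and compositions of integers *)

Section Coarsenings.
Context (V : nmodType).
Implicit Types (a : V) (x u : seq V).

(** The new letter either forms a block of its own or joins the first block. *)
Definition prepend a x : seq (seq V) :=
  if x is b :: x' then [:: a :: x; a + b :: x'] else [:: [:: a]].

Fixpoint coarsenings u : seq (seq V) :=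
  if u is a :: u' then [seq y | x <- coarsenings u', y <- prepend a x]
  else [:: [::]].

Lemma big_coarsenings_cons (W : nmodType) (F : seq V -> W) a u :
  \sum_(x <- coarsenings (a :: u)) F x =
  \sum_(x <- coarsenings u) \sum_(y <- prepend a x) F y.
Proof. exact: big_allpairs_dep. Qed.

Lemma mem_coarsenings_cons a u y :
  y \in coarsenings (a :: u) -> exists b y', y = b :: y'.
Proof.
move=> /allpairsPdep[[|b x] [z [_ /= + ->]]].
  by rewrite inE => /eqP->; exists a, [::].
by rewrite !inE => /orP[] /eqP->; [exists a, (b :: x)|exists (a + b), x].
Qed.

End Coarsenings.

(** A composition of [n] is a coarsening of a word of [n] ones, so one recursion serves both
    enumerations. *)
Definition compositions (n : nat) : seq (seq nat) := coarsenings (nseq n 1%N).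

Lemma mem_compositions n L : (L \in compositions n) = composition_of n L.
Proof.
rewrite /composition_of; elim: n L => [|n IH] L.
  by case: L => [|[|l] L]; rewrite // inE /= andbF.
apply/allpairsPdep/idP => [[K [M [+ KM ->]]]|].
  rewrite IH => /andP[K0 /eqP Kn]; move: KM K0 Kn.
  case: K => [|l K] /=; first by rewrite inE => /eqP-> /= _ <-.
  rewrite !inE => /orP[] /eqP-> /=; rewrite !inE ?negb_or => /andP[l0 K0] <-.
    by rewrite l0 K0 /= eqxx.
  by rewrite K0 /= eqxx.
case: L => [|[|[|l]] L] //=; rewrite inE eqSS => /andP[L0 /eqP Ln].
  exists L, (1%N :: L); split=> //; first by rewrite IH L0 Ln /=.
  by case: (L) => [|l K]; rewrite /= !inE eqxx.
exists (l.+1 :: L), (l.+2 :: L); split=> //; last by rewrite !inE eqxx orbT.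
by rewrite IH inE /= L0 -Ln eqxx.
Qed.

Lemma uniq_compositions n : uniq (compositions n).
Proof.
elim: n => // n IH; apply: allpairs_uniq_dep => //.
  move=> [|l K] //; rewrite mem_compositions /composition_of inE negb_or.
  by move=> /andP[/andP[l0 _] _]; rewrite /= inE eqseq_cons; case: l l0.
have pos K : K \in compositions n -> 0%N \notin K.
  by rewrite mem_compositions => /andP[].
(* The first part of [M] tells whether the unit was merged: it is 1 if not, and at least 2 if so,
   because the parts of [K] are positive. *)
have unprepend K M : K \in compositions n -> M \in prepend 1%N K ->
    K = if M is l.+2 :: M' then l.+1 :: M' else behead M.
  move=> /pos; case: K => [|[|l] K] //= _; first by rewrite inE => /eqP->.
  by rewrite !inE => /orP[] /eqP->.
move=> _ _ /allpairsPdep[K [M [Kn KM ->]]] /allpairsPdep[K' [M' [Kn' KM' ->]]].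
move=> /= e; have eK : K = K'.
  by rewrite (unprepend K M) // (unprepend K' M') // e.
by rewrite e eK.
Qed.

(** * Cancellation behind the left antipode identity *)

Section Antipode.
Context (m : nat) (E : exponentType).
Local Notation mexp := {ffun 'I_m -> E}.
Local Arguments qshuffle : simpl never.
Implicit Types u v w x : seq mexp.

(** Prepending a part 1 to a composition has the same two outcomes as prepending a letter to the
    coarsened word. *)
Lemma coarseningsE u :
  coarsenings u = [seq coarsen L u | L <- compositions (size u)].
Proof.
elim: u => [//|a u IH].
have step L : [seq coarsen M (a :: u) | M <- prepend 1%N L] =
    prepend a (coarsen L u).
  case: L => [|l L]; rewrite /coarsen /= !big_cons ?take0 ?drop0 big_nil;
    by rewrite addr0.
rewrite -[LHS]/[seq y | x <- coarsenings u, y <- prepend a x] IH.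
rewrite -[compositions (size (a :: u))]
  /[seq M | L <- compositions (size u), M <- prepend 1%N L].
rewrite map_allpairs; elim: (compositions _) => //= L s ->.
by rewrite !map_id step.
Qed.

Section Telescoping.
Context (k : pzRingType) (V : lmodType k) (G : seq mexp -> V).

(** For [G] sending a word to its quasi-monomial, this is the product of [M_v] with the sum of the
    [M_x] over the coarsenings [x] of [u]. *)
Let T u v := \sum_(x <- coarsenings u) \sum_(z <- qshuffle x v) G z.

(* The part of [T u v] where the first letter comes from the first argument of
   the quasi-shuffle alone. *)
Let Q u v := \sum_(x <- coarsenings u)
  if x is a :: x' then \sum_(z <- qshuffle x' v) G (a :: z) else 0.

(** If the first letter of the result involves [b], then [b] stands alone or is added to the first
    letter of [x]; these are the two ways of prepending [b] to [x]. *)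
Let T_cons u b v : T u (b :: v) = Q u (b :: v) + Q (b :: u) v.
Proof.
rewrite /Q big_coarsenings_cons -big_split; apply: eq_bigr => -[|a x] _ /=.
  by rewrite add0r !big_seq1.
rewrite big_cons big_seq1 qshuffle_cons !big_cat !big_map /=.
by rewrite [b + a]addrC.
Qed.

Let T_nil a u : T (a :: u) [::] = Q (a :: u) [::].
Proof.
apply: eq_big_seq => _ /mem_coarsenings_cons[b [x ->]].
by rewrite !qshuffles0 !big_seq1.
Qed.

(** Here [u] accumulates the reversed prefix already read. By induction the cuts past the first
    letter [b] of [v] sum to [- Q (b :: u) v], which cancels the second term of [T_cons]. *)
Let telescope u v : u ++ v != [::] ->
  \sum_(p <- cuts v) (-1) ^+ size p.1 *: T (catrev p.1 u) p.2 = Q u v.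
Proof.
elim: v u => [|b v IH] u.
  rewrite cats0 big_seq1 scale1r; case: u => // a u _; exact: T_nil.
move=> _; rewrite /= big_cons big_map scale1r /= T_cons.
under eq_bigr => p _ do rewrite exprS mulN1r scaleNr.
by rewrite sumrN IH // addrK.
Qed.

Lemma antipode_telescope w : w != [::] ->
  \sum_(p <- cuts w) (-1) ^+ size p.1 *:
     \sum_(x <- coarsenings (rev p.1)) \sum_(z <- qshuffle x p.2) G z = 0.
Proof. by move=> w0; rewrite (telescope (u := [::])) // /Q big_seq1. Qed.

End Telescoping.
End Antipode.

(** * Linear and bilinear maps on tensor products *)

Section TensorLinear.
Context (k : comNzRingType).
Implicit Types (M N P : lmodType k).

Lemma linear_sum_of M N (f : M -> N) I (r : seq I) (F : I -> M) : linear f ->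
  f (\sum_(i <- r) F i) = \sum_(i <- r) f (F i).
Proof.
move=> fl; pose fL := GRing.isLinear.Build k M N _ f fl.
pose g : {linear M -> N} := HB.pack f fL.
exact: (raddf_sum g).
Qed.

Lemma linear_scale_of M N (f : M -> N) a x : linear f -> f (a *: x) = a *: f x.
Proof.
move=> fl; have f0 : f 0 = 0.
  by have := fl (-1) 0 0; rewrite scaler0 addr0 scaleN1r addNr.
by rewrite -[a *: x]addr0 fl f0 addr0.
Qed.

Lemma linear_comp_of M N P (f : N -> P) (g : M -> N) :
  linear f -> linear g -> linear (f \o g).
Proof. by move=> fl gl a x y /=; rewrite gl fl. Qed.

Lemma bilin_comp M N M' N' P (f : M -> N -> P) (g : M' -> M) (h : N' -> N) :
  bilin f -> linear g -> linear h -> bilin (fun x y => f (g x) (h y)).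
Proof.
by move=> [fr fl] gl hl; split=> [x|y] a u v; rewrite ?gl ?hl ?(fr, fl _ a).
Qed.

Lemma linear_id M : linear (@id M). Proof. by []. Qed.

Lemma tlift_sum M N P (f : M -> N -> P) I (r : seq I) x y : bilin f ->
  tlift f (\sum_(i <- r) tens (x i) (y i)) = \sum_(i <- r) f (x i) (y i).
Proof.
move=> fB; rewrite linear_sum_of; last exact: tlift_lin.
by apply: eq_bigr => i _; rewrite tliftE.
Qed.

Lemma tens_suml M N I (r : seq I) (x : I -> M) (y : N) :
  tens (\sum_(i <- r) x i) y = \sum_(i <- r) tens (x i) y.
Proof. exact: linear_sum_of ((tens_bilin M N).2 y). Qed.

Lemma tens_sumr M N I (r : seq I) (x : M) (y : I -> N) :
  tens x (\sum_(i <- r) y i) = \sum_(i <- r) tens x (y i).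
Proof. exact: linear_sum_of ((tens_bilin M N).1 x). Qed.

Lemma bilin_tmap M N M' N' (f : M -> M') (g : N -> N') :
  linear f -> linear g -> bilin (fun x y => tens (f x) (g y)).
Proof. by move=> fl gl; apply: bilin_comp => //; exact: tens_bilin. Qed.

Lemma bilin_tassoc M N P :
  bilin (fun (t : tensor M N) (z : P) =>
           tlift (fun x y => tens x (tens y z)) t).
Proof.
have [tr tl] := tens_bilin N P.
have B (z : P) : bilin (fun (x : M) (y : N) => tens x (tens y z)).
  exact: bilin_comp (tens_bilin M _) (@linear_id M) (tl z).
split=> [t|z]; last exact: tlift_lin.
move=> a z z'; rewrite -tlift_linf; apply: eq_tlift => x y.
by rewrite tr (tens_bilin M _).1.
Qed.

Lemma tassoc_tens M N P (x : M) (y : N) (z : P) :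
  tassoc (tens (tens x y) z) = tens x (tens y z).
Proof.
rewrite /tassoc tliftE; last exact: bilin_tassoc.
rewrite tliftE //.
exact: bilin_comp (tens_bilin M _) (@linear_id M) ((tens_bilin N P).2 z).
Qed.

Lemma tassoc_lin M N P : linear (@tassoc k M N P).
Proof. exact: tlift_lin (@bilin_tassoc M N P). Qed.

End TensorLinear.

(** * The quasi-monomials as a basis, and linear extension from it *)

Section Basis.
Context (k : comNzRingType) (m : nat) (E : exponentType).
Local Notation mexp := {ffun 'I_m -> E}.
Local Notation multicomp := (multicomp m E).
Local Notation MQSym := (MQSym k m E).
Local Notation M := (@MQSym_M k m E).
Local Arguments qshuffle : simpl never.

Lemma MQSym_ind (P : MQSym -> Prop) : P 0 ->
  (forall a w f, P f -> P (a *: M w + f)) -> forall f, P f.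
Proof.
(* Span induction runs over bare series, on which [P] is not defined, so an element of [MQSym] with
   the given series is carried along. *)
move=> P0 PD f; suff [g gf Pg] : exists2 g : MQSym, val g = val f & P g.
  by have <- : g = f by exact/val_inj.
move: (val f) (valP f); apply: kspan_ind => [|a _ x [w _ <-] [g <- Pg]].
  by exists 0.
by exists (a *: M w + g); [|exact: PD].
Qed.

Lemma MQSym_linear_eq (V : lmodType k) (f g : MQSym -> V) :
  linear f -> linear g -> (forall w, f (M w) = g (M w)) -> f =1 g.
Proof.
move=> fl gl fg; apply: MQSym_ind => [|a w h IH]; last by rewrite fl gl fg IH.
by rewrite -(scale0r 0) !linear_scale_of ?scale0r.
Qed.

Definition leading (w : seq mexp) : monomial ('I_m * nat)%type E :=
  \sum_(i < size w) xpow i w`_i.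

Definition mcoef (w : multicomp) (f : MQSym) : k := val f (leading w).

Lemma mcoef_linear w : scalar (mcoef w).
Proof. by []. Qed.

(** The columns of the leading monomial of [w] are the letters of [w]; none is zero, so packing
    gives back [w]. The functionals [mcoef w] are thus dual to the quasi-monomials. *)
Lemma mcoefM w v : mcoef w (M v) = (v == w)%:R.
Proof.
have colE p : Defs.col (leading w) p = (w : seq mexp)`_p.
  rewrite (col_sum (fun i => val i) (fun i => (w : seq mexp)`_i)).
  have [pw|wp] := ltnP p (size w); last first.
    rewrite nth_default // big1 // => i _; case: eqP => // pi.
    by move: wp; rewrite pi leqNgt ltn_ord.
  rewrite (bigD1 (Ordinal pw)) //= eqxx big1 ?addr0 // => i.
  by rewrite -val_eqE /= eq_sym => /negPf->.
have packE : pack (size w) (leading w) = w.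
  rewrite /pack /cols (eq_map colE) -/(mkseq _ _) mkseq_nth.
  apply/all_filterP/allP => g gw.
  by apply: contraNneq (mc_neq0 w) => <-.
have wb : bounded (size w) (leading w).
  by move=> p wp; rewrite colE nth_default.
by rewrite /mcoef /= (qmonomialE _ (mc_neq0 v) wb) packE eq_sym.
Qed.

Lemma mcoef_finite (f : MQSym) :
  exists D : {fset multicomp}, forall w, w \notin D -> mcoef w f = 0.
Proof.
elim/MQSym_ind: f => [|a v f [D fD]]; first by exists fset0.
exists (v |` D)%fset => w; rewrite !inE negb_or => /andP[wv wD].
by rewrite mcoef_linear mcoefM eq_sym (negPf wv) mulr0 add0r fD.
Qed.

Definition mcoef_supp (f : MQSym) : {fset multicomp} :=
  projT1 (cid (mcoef_finite f)).

Section Lift.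
Context (V : lmodType k) (g : multicomp -> V).

Definition MQSym_lift (f : MQSym) : V :=
  \sum_(w <- mcoef_supp f) mcoef w f *: g w.

(** The finite set chosen in [mcoef_supp] does not matter: it and [D] both extend to their union by
    vanishing terms. *)
Lemma MQSym_liftE (D : {fset multicomp}) f :
  (forall w, w \notin D -> mcoef w f = 0) ->
  MQSym_lift f = \sum_(w <- D) mcoef w f *: g w.
Proof.
have fS w : w \notin mcoef_supp f -> mcoef w f = 0.
  by rewrite /mcoef_supp; case: cid => /= S; apply.
move=> fD; rewrite /MQSym_lift.
rewrite (big_fset_incl _ (fsubsetUl _ D)); last first.
  by move=> w _ /fS->; rewrite scale0r.
rewrite [RHS](big_fset_incl _ (fsubsetUr (mcoef_supp f) D)) // => w _ /fD->.
by rewrite scale0r.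
Qed.

Lemma MQSym_lift_linear : linear MQSym_lift.
Proof.
move=> a f h.
have [S fS] := mcoef_finite f; have [S' hS] := mcoef_finite h.
have fD w : w \notin (S `|` S')%fset -> mcoef w f = 0.
  by rewrite inE negb_or => /andP[/fS].
have hD w : w \notin (S `|` S')%fset -> mcoef w h = 0.
  by rewrite inE negb_or => /andP[_ /hS].
rewrite (MQSym_liftE fD) (MQSym_liftE hD) (MQSym_liftE (D := (S `|` S')%fset)).
  rewrite scaler_sumr -big_split; apply: eq_bigr => w _ /=.
  by rewrite mcoef_linear scalerDl scalerA.
by move=> w wD; rewrite mcoef_linear fD // hD // mulr0 addr0.
Qed.

HB.instance Definition _ :=
  GRing.isLinear.Build k MQSym V _ MQSym_lift MQSym_lift_linear.

Lemma MQSym_liftM w : MQSym_lift (M w) = g w.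
Proof.
rewrite (MQSym_liftE (D := [fset w]%fset)).
  by rewrite big_seq_fset1 mcoefM eqxx scale1r.
by move=> v; rewrite inE mcoefM eq_sym => /negPf->.
Qed.

End Lift.

(* [M] indexed by words; junk when the word contains the zero exponent. *)
Definition mqs (w : seq mexp) : MQSym := M (insubd mc_nil w).

Lemma mqsE (w : multicomp) : M w = mqs w.
Proof. by rewrite /mqs valKd. Qed.

Lemma mqs_series w : 0 \notin w -> MQSym_series (mqs w) = qmonomial k w.
Proof. by move=> w0; rewrite /mqs /= insubdK. Qed.

Lemma MQSym_series_inj : injective (@MQSym_series k m E).
Proof. exact: val_inj. Qed.

Lemma MQSym_seriesM (f g : MQSym) :
  MQSym_series (f * g) = MQSym_series f * MQSym_series g.
Proof. by rewrite [LHS](rmorphM val). Qed.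

Lemma MQSym_series_sum I (r : seq I) (F : I -> MQSym) :
  MQSym_series (\sum_(i <- r) F i) = \sum_(i <- r) MQSym_series (F i).
Proof. exact: (raddf_sum val). Qed.

Lemma mqs_nil : mqs [::] = 1.
Proof.
apply: MQSym_series_inj; rewrite mqs_series //.
by rewrite [RHS](rmorph1 val) qmonomial_nil.
Qed.

Lemma mqsM (u v : seq mexp) : 0 \notin u -> 0 \notin v ->
  mqs u * mqs v = \sum_(w <- qshuffle u v) mqs w.
Proof.
move=> u0 v0; apply: MQSym_series_inj; rewrite MQSym_seriesM MQSym_series_sum.
rewrite !mqs_series // qmonomialM //; apply: eq_big_seq => w wq.
by rewrite mqs_series // (qshuffle_neq0 u0 v0).
Qed.

End Basis.

(** * The structure maps and the Hopf algebra axioms *)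

Section Hopf.
Context (k : comNzRingType) (m : nat) (E : exponentType).
Local Notation mexp := {ffun 'I_m -> E}.
Local Notation multicomp := (multicomp m E).
Local Notation MQSym := (MQSym k m E).
Local Notation M := (@MQSym_M k m E).
Local Notation mqs := (@mqs k m E).
Local Arguments qshuffle : simpl never.
Implicit Types (w x : seq mexp) (f g : MQSym).

Lemma coarsenings_neq0 w x : 0 \notin w -> x \in coarsenings w -> 0 \notin x.
Proof.
move=> w0; rewrite coarseningsE => /mapP[L + ->]; rewrite mem_compositions.
by move/coarsen_neq0; apply.
Qed.

Lemma cuts_neq0 w p : 0 \notin w -> p \in cuts w ->
  0 \notin p.1 /\ 0 \notin p.2.
Proof.
move=> w0 /mem_cuts pw; move: w0.
by rewrite -pw mem_cat negb_or => /andP[].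
Qed.

Lemma MQSym_eq_mqs (V : lmodType k) (F G : MQSym -> V) :
  linear F -> linear G -> (forall w, 0 \notin w -> F (mqs w) = G (mqs w)) ->
  F =1 G.
Proof.
move=> Fl Gl FG; apply: MQSym_linear_eq => // w.
by rewrite mqsE FG // mc_neq0.
Qed.

Definition MQSym_comul : {linear MQSym -> tensor MQSym MQSym} :=
  MQSym_lift (fun w : multicomp => \sum_(p <- cuts w) tens (mqs p.1) (mqs p.2)).

Definition MQSym_antipode : {linear MQSym -> MQSym} :=
  MQSym_lift (fun w : multicomp =>
    (-1) ^+ size w *: \sum_(x <- coarsenings (rev w)) mqs x).

HB.instance Definition _ := GRing.isLinear.Build k MQSym k _
  (mcoef mc_nil) (@mcoef_linear k m E mc_nil).
(** The constant term of the series, as the leading monomial of the empty word is 1. *)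
Definition MQSym_counit : {scalar MQSym} := mcoef mc_nil.

Lemma comul_mqs w : 0 \notin w ->
  MQSym_comul (mqs w) = \sum_(p <- cuts w) tens (mqs p.1) (mqs p.2).
Proof. by move=> w0; rewrite -(mqsE k (MultiComp w0)) /= MQSym_liftM. Qed.

Lemma antipode_mqs w : 0 \notin w -> MQSym_antipode (mqs w) =
  (-1) ^+ size w *: \sum_(x <- coarsenings (rev w)) mqs x.
Proof. by move=> w0; rewrite -(mqsE k (MultiComp w0)) /= MQSym_liftM. Qed.

Lemma counit_mqs w : 0 \notin w -> MQSym_counit (mqs w) = (w == [::])%:R.
Proof. by move=> w0; rewrite -(mqsE k (MultiComp w0)) /= mcoefM. Qed.

Lemma MQSym_coalgebra : is_coalgebra MQSym_comul MQSym_counit.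
Proof.
have scale_bilinl : bilin (fun f g => MQSym_counit f *: g).
  split=> [f|g] a x y; first by rewrite scalerDr !scalerA mulrC.
  by rewrite linearP scalerDl scalerA.
have scale_bilinr : bilin (fun f g => MQSym_counit g *: f).
  by split=> [f|g]; [exact: scale_bilinl.2|exact: scale_bilinl.1].
have idl := @linear_id k MQSym.
have Dl : linear MQSym_comul by exact: linearP.
split.
- have Bl := bilin_tmap Dl idl; have Br := bilin_tmap idl Dl.
  apply: MQSym_eq_mqs => [||w w0].
  + have := linear_comp_of (tlift_lin Bl) Dl.
    exact: linear_comp_of (@tassoc_lin k _ _ _).
  + exact: linear_comp_of (tlift_lin Br) Dl.
  rewrite comul_mqs // /tmap (tlift_sum _ _ _ Bl) (tlift_sum _ _ _ Br).
  rewrite linear_sum_of; last exact: tassoc_lin.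
  under eq_big_seq => p /(cuts_neq0 w0)[p0 _].
    rewrite comul_mqs // tens_suml linear_sum_of; last exact: tassoc_lin.
    under eq_bigr => q _ do rewrite tassoc_tens.
    over.
  under [RHS]eq_big_seq => p /(cuts_neq0 w0)[_ p0].
    rewrite comul_mqs // tens_sumr; over.
  exact: (big_cuts_coassoc (fun x y z => tens (mqs x) (tens (mqs y) (mqs z)))).
- apply: MQSym_eq_mqs => [||w w0]; [|by []|].
    exact: linear_comp_of (tlift_lin scale_bilinl) Dl.
  rewrite comul_mqs // tlift_sum // -[RHS](big_cuts_nill (fun=> mqs)).
  apply: eq_big_seq => p /(cuts_neq0 w0)[p0 _].
  by rewrite counit_mqs // scaler_nat.
- apply: MQSym_eq_mqs => [||w w0]; [|by []|].
    exact: linear_comp_of (tlift_lin scale_bilinr) Dl.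
  rewrite comul_mqs // tlift_sum //.
  rewrite -[RHS](big_cuts_nilr (fun x _ => mqs x)).
  apply: eq_big_seq => p /(cuts_neq0 w0)[_ p0].
  by rewrite counit_mqs // scaler_nat.
Qed.

Lemma comul1 : MQSym_comul 1 = 1.
Proof. by rewrite -mqs_nil comul_mqs // big_seq1 mqs_nil. Qed.

Lemma comulM : {morph MQSym_comul : f g / f * g}.
Proof.
have Dl : linear MQSym_comul by exact: linearP.
move=> f g; move: f; apply: MQSym_eq_mqs => [a f f'|a f f'|u u0].
- by rewrite mulrDl -scalerAl Dl.
- by rewrite Dl; exact: tmul_linl.
move: g; apply: MQSym_eq_mqs => [a g g'|a g g'|v v0].
- by rewrite mulrDr -scalerAr Dl.
- by rewrite Dl; exact: tmul_linr.
rewrite mqsM // linear_sum_of //.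
under eq_big_seq => w /(qshuffle_neq0 u0 v0) w0 do rewrite comul_mqs //.
rewrite (big_cuts_qshuffle (fun x y => tens (mqs x) (mqs y))) !comul_mqs //.
rewrite mulr_suml; apply: eq_big_seq => p /(cuts_neq0 u0)[p1 p2].
rewrite mulr_sumr; apply: eq_big_seq => q /(cuts_neq0 v0)[q1 q2].
rewrite [RHS]tmul_tens !mqsM // tens_suml; apply: eq_bigr => x _.
by rewrite tens_sumr.
Qed.

Lemma counit_monoid_morphism : monoid_morphism MQSym_counit.
Proof.
split; first by rewrite -mqs_nil counit_mqs.
(* The target is [k] regarded as a module over itself. *)
move=> f g; move: f; apply: (@MQSym_eq_mqs k^o) => [a f f'|a f f'|u u0].
- by rewrite mulrDl -scalerAl linearP.
- by rewrite linearP mulrDl -mulrA.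
move: g; apply: (@MQSym_eq_mqs k^o) => [a g g'|a g g'|v v0].
- by rewrite mulrDr -scalerAr linearP.
- by rewrite linearP mulrDr mulrCA.
have el : linear (MQSym_counit : MQSym -> k^o) by exact: linearP.
rewrite mqsM // [LHS](linear_sum_of _ _ el) !counit_mqs //.
under eq_big_seq => w /(qshuffle_neq0 u0 v0) w0 do rewrite counit_mqs //.
(* If a factor is empty, the quasi-shuffle is the other factor alone; otherwise all its words are
   nonempty and both sides vanish. *)
case: u u0 => [|a u] u0; first by rewrite big_seq1 mul1r.
case: v v0 => [|b v] v0; first by rewrite qshuffles0 big_seq1 mulr1.
by rewrite qshuffle_cons !big_cat !big_map /= !big1 // !addr0 mulr0.
Qed.

Lemma antipode_left w : 0 \notin w ->
  \sum_(p <- cuts w) MQSym_antipode (mqs p.1) * mqs p.2 = (w == [::])%:R.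
Proof.
move=> w0; have [->|wn] := eqVneq w [::].
  by rewrite big_seq1 antipode_mqs // big_seq1 scale1r mqs_nil mul1r.
rewrite -[RHS](antipode_telescope mqs wn).
apply: eq_big_seq => p /(cuts_neq0 w0)[p1 p2].
rewrite antipode_mqs // -scalerAl mulr_suml; congr (_ *: _).
apply: eq_big_seq => x xp; rewrite mqsM //.
by apply: coarsenings_neq0 xp; rewrite mem_rev.
Qed.

Lemma antipode_right w : 0 \notin w ->
  \sum_(p <- cuts w) mqs p.1 * MQSym_antipode (mqs p.2) = (w == [::])%:R.
Proof.
apply: (cuts_inverse_sym (P := fun w => 0 \notin w)
  (s := fun w => MQSym_antipode (mqs w))).
- by move=> u v; rewrite mem_cat negb_or.
- exact: mqs_nil.
- by rewrite antipode_mqs // big_seq1 scale1r mqs_nil.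
- exact: antipode_left.
Qed.

Lemma MQSym_hopf : is_hopf_algebra MQSym_comul MQSym_counit MQSym_antipode.
Proof.
have unit_linear : linear (fun f => (MQSym_counit f)%:A : MQSym).
  by move=> a f g; rewrite linearP scalerDl scalerA.
split.
- split; [exact: MQSym_coalgebra|split|exact: counit_monoid_morphism].
    exact: comul1.
  exact: comulM.
- have B : bilin (fun f g => MQSym_antipode f * g).
    split=> [f|g] a x y; first by rewrite mulrDr -scalerAr.
    by rewrite linearP mulrDl -scalerAl.
  apply: MQSym_eq_mqs => // [|w w0].
    by apply: linear_comp_of; [exact: tlift_lin|exact: linearP].
  rewrite comul_mqs // tlift_sum // antipode_left // counit_mqs //.
  by rewrite scaler_nat.
- have B : bilin (fun f g => f * MQSym_antipode g).
    split=> [f|g] a x y; first by rewrite linearP mulrDr -scalerAr.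
    by rewrite mulrDl -scalerAl.
  apply: MQSym_eq_mqs => // [|w w0].
    by apply: linear_comp_of; [exact: tlift_lin|exact: linearP].
  rewrite comul_mqs // tlift_sum // antipode_right // counit_mqs //.
  by rewrite scaler_nat.
Qed.

End Hopf.

Theorem proposition3p4 (k : comNzRingType) (iota : {rmorphism rat -> k})
    (m : nat) (m_gt0 : (0 < m)%N) (E : exponentType) :
  exists (Delta : {linear MQSym k m E -> tensor (MQSym k m E) (MQSym k m E)})
         (eps : {scalar MQSym k m E})
         (S : {linear MQSym k m E -> MQSym k m E}),
    [/\ forall w : multicomp m E,
          Delta (MQSym_M k w) =
          \sum_(0 <= i < (size w).+1)
             tens (MQSym_M k (mc_take i w)) (MQSym_M k (mc_drop i w)),
        forall w : multicomp m E, eps (MQSym_M k w) = (w == mc_nil)%:R,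
        forall w : multicomp m E,
          S (MQSym_M k w) =
          (-1) ^+ size w *:
            \sum_(L \in [set L : seq nat | composition_of (size w) L])
               MQSym_M k (mc_coarsen L (mc_rev w)),
        S (MQSym_M k mc_nil) = MQSym_M k mc_nil /\
        MQSym_M k (@mc_nil m E) = 1
      & is_hopf_algebra Delta eps S].
Proof.
exists (MQSym_comul k m E), (MQSym_counit k m E), (MQSym_antipode k m E).
have M1 : MQSym_M k (@mc_nil m E) = 1 by rewrite mqsE mqs_nil.
split.
- move=> w; rewrite mqsE comul_mqs ?mc_neq0 // cutsE big_map /index_iota subn0.
  by apply: eq_bigr => i _; rewrite !mqsE.
- by move=> w; rewrite mqsE counit_mqs ?mc_neq0.
- move=> w; rewrite mqsE antipode_mqs ?mc_neq0 // coarseningsE big_map size_rev.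
  (* The sum over a list becomes a sum over a set because no composition is listed twice. *)
  rewrite (fsbig_seq _ _ (uniq_compositions _)); congr (_ *: _).
  have -> : [set` compositions (size w)] = [set L | composition_of (size w) L].
    by apply/seteqP; split=> L /=; rewrite mem_compositions.
  apply: eq_fsbigr => L; rewrite inE => wL.
  by rewrite mqsE mc_coarsenE ?size_rev.
- by rewrite M1 -mqs_nil antipode_mqs // big_seq1 scale1r.
- exact: MQSym_hopf.
Qed.
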